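(* Let $(M^{2m},\varphi,g)$ be a para-Kähler-Norden manifold, $T^{\varphi}_{1}M$ its $\varphi$-unit tangent bundle equipped with the $\varphi$-Sasaki metric, and $F$ a $(1,1)$-tensor field on $M$. A curve $\Gamma=(\gamma(t),\xi(t))$ on $T^{\varphi}_{1}M$ is an ${}^{H}F$-geodesic with respect to $\widehat\nabla$ if and only if $$\gamma_t''=R(\xi_t',\varphi\xi)\gamma_t'+F\gamma_t',\qquad \xi_t''=F\xi_t'-\rho^2\xi,$$ where $\rho$ is a constant with $0\le\rho\le1$ and $\rho^2=g(\xi_t',\varphi\xi_t')$.
   Context: A para-Kähler-Norden manifold $(M^{2m},\varphi,g)$ is a $2m$-dimensional Riemannian manifold $(M,g)$ with a $(1,1)$-tensor field $\varphi$ such that $\varphi^2=\mathrm{id}$, $\varphi\ne\pm\mathrm{id}$, the $+1$ and $-1$ eigenbundles of $\varphi$ have equal rank, $g(\varphi X,Y)=g(X,\varphi Y)$, and $\nabla\varphi=0$, where $\nabla$ is the Levi-Civita connection of $g$. $R(X,Y)Z=\nabla_X\nabla_YZ-\nabla_Y\nabla_XZ-\nabla_{[X,Y]}Z$. Points of $TM$ are written $(x,\xi)$; ${}^{H}X$, ${}^{V}X$ are the horizontal (with respect to $\nabla$) and vertical lifts to $TM$. The $\varphi$-Sasaki metric $g^\varphi$ on $TM$ is defined by $g^\varphi({}^HX,{}^HY)=g(X,Y)$, $g^\varphi({}^HX,{}^VY)=0$, $g^\varphi({}^VX,{}^VY)=g(X,\varphi Y)$. The $\varphi$-unit tangent bundle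 is the hypersurface $T^{\varphi}_{1}M=\{(x,\xi)\in TM: g(\xi,\varphi\xi)=1\}$, equipped with the metric induced by $g^\varphi$; $\widehat\nabla$ is the Levi-Civita connection of this induced metric. The horizontal lift ${}^HF$ of $F$ is the $(1,1)$-tensor field on $TM$ with ${}^HF({}^HX)={}^H(FX)$ and ${}^HF({}^VX)={}^V(FX)$. A curve $\Gamma=(\gamma(t),\xi(t))$ consists of a curve $\gamma$ on $M$ and a vector field $\xi$ along $\gamma$. Write $\gamma_t'=d\gamma/dt$, $\gamma_t''=\nabla_{\gamma_t'}\gamma_t'$, $\xi_t'=\nabla_{\gamma_t'}\xi$, $\xi_t''=\nabla_{\gamma_t'}\xi_t'$; then $\Gamma_t'={}^H\gamma_t'+{}^V\xi_t'$. $\Gamma$ is an ${}^HF$-geodesic with respect to $\widehat\nabla$ if $\widehat\nabla_{\Gamma_t'}\Gamma_t'={}^HF\,\Gamma_t'$ (an equality of vectors tangent to $TM$ along $\Gamma$).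
   Formalization: That a constant ρ with 0≤ρ≤1 and ρ²=g(ξ',φξ') exists is assumed of the curve, not concluded: on flat R² with φ=diag(1,-1), F=0, γ constant, ξ=(cosh t, sinh t), Γ is a geodesic but g(ξ',φξ')=-1. *)

(* Defs.v *)
From HB Require Import structures.
From mathcomp Require Import all_boot all_order all_algebra.
From mathcomp Require Import all_classical all_reals all_analysis.

Set Implicit Arguments.
Unset Strict Implicit.
Unset Printing Implicit Defensive.

Import Order.TTheory GRing.Theory Num.Theory.
Import numFieldNormedType.Exports.

Local Open Scope classical_set_scope.
Local Open Scope ring_scope.

(* Geometry is done in charts.  Tangent vectors are row vectors, so a linear
   map or a (1,1)-tensor with matrix A acts by X |-> X *m A, and a (0,2)-tensor
   with matrix B is the form (X, Y) |-> X *m B *m Y^T. *)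

Section Smooth.
Variable R : realType.

Fixpoint Ck (k : nat) (V W : normedModType R) (U : set V) (f : V -> W) : Prop :=
  match k with
  | 0 => forall x, U x -> {for x, continuous f}
  | j.+1 => (forall x, U x -> differentiable f x) /\
            forall v, Ck j U (fun x => 'D_v f x)
  end.

(* C^infinity; meant for U open and V finite-dimensional. *)
Definition smooth_on (V W : normedModType R) (U : set V) (f : V -> W) : Prop :=
  forall k, Ck k U f.

End Smooth.

Section Manifolds.
Variable R : realType.

(* [transition a b] is the change of coordinates (coords b) o (coords a)^-1; its values
   outside [overlap a b] are irrelevant. *)
Record atlas (n : nat) := Atlas {
  mpoint :> Type;
  chart : Type;
  dom : chart -> set mpoint;
  coords : chart -> mpoint -> 'rV[R]_n;
  transition : chart -> chart -> 'rV[R]_n -> 'rV[R]_n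
}.

Definition cimage n (A : atlas n) (a : chart A) : set 'rV[R]_n :=
  coords a @` dom a.

Definition overlap n (A : atlas n) (a b : chart A) : set 'rV[R]_n :=
  coords a @` (dom a `&` dom b).

(* The topology induced by the atlas. *)
Definition aopen n (A : atlas n) (O : set A) : Prop :=
  forall x, O x ->
    exists a : chart A, dom a x /\ nbhs (coords a x) (coords a @` (dom a `&` O)).

Record is_manifold n (A : atlas n) : Prop := IsManifold {
  dom_cover : forall x : A, exists a : chart A, dom a x;
  coord_inj : forall (a : chart A) x y,
    dom a x -> dom a y -> coords a x = coords a y -> x = y;
  overlap_open : forall a b : chart A, open (overlap a b);
  transE : forall (a b : chart A) x,
    dom a x -> dom b x -> transition a b (coords a x) = coords b x;
  trans_smooth : forall a b : chart A, smooth_on (overlap a b) (transition a b);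
  atlas_hausdorff : forall x y : A, x <> y ->
    exists O1 O2 : set A,
      [/\ aopen O1, aopen O2, O1 x, O2 y & O1 `&` O2 = set0];
  atlas_second_countable : exists B : nat -> set A,
    (forall i, aopen (B i)) /\
    forall (O : set A) x, aopen O -> O x -> exists i, B i x /\ B i `<=` O
}.

(* A tangent vector at x is the family of its components in the charts around x,
   related by the Jacobians of the coordinate changes.  Components in the other
   charts are set to 0 so that equality of tangent vectors is the right one. *)
Record tangent n (A : atlas n) (x : A) := Tangent {
  tcomp :> chart A -> 'rV[R]_n;
  tcomp_law : forall a b : chart A, dom a x -> dom b x ->
    tcomp b = 'd (transition a b) (coords a x) (tcomp a);
  tcomp_out : forall a : chart A, ~ dom a x -> tcomp a = 0
}.

Definition tbundle n (A : atlas n) : atlas (n + n) := {|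
  mpoint := {x : A & tangent x};
  chart := chart A;
  dom := fun a => [set p | dom a (projT1 p)];
  coords := fun a p => row_mx (coords a (projT1 p)) (projT2 p a);
  transition := fun a b z =>
    row_mx (transition a b (lsubmx z)) ('d (transition a b) (lsubmx z) (rsubmx z))
|}.

Definition base n (A : atlas n) (p : tbundle A) : A := projT1 p.

Definition fiber n (A : atlas n) (p : tbundle A) : tangent (base p) := projT2 p.

(* On the open set I of parameters; the first half is continuity. *)
Definition smooth_curve n (A : atlas n) (I : set R) (c : R -> A) : Prop :=
  forall a : chart A,
    open (I `&` [set t | dom a (c t)]) /\
    smooth_on (I `&` [set t | dom a (c t)]) (fun t => coords a (c t)).

(* Smooth local parametrizations of an embedded k-dimensional submanifold S of A,
   i.e. the inverses of the charts of S. *)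
Record lparam n (A : atlas n) (S : set A) (k : nat) := Lparam {
  pdom : set 'rV[R]_k;
  pfun :> 'rV[R]_k -> A;
  pdom_open : open pdom;
  pfun_in : forall w, pdom w -> S (pfun w);
  pfun_inj : forall w w', pdom w -> pdom w' -> pfun w = pfun w' -> w = w';
  pfun_smooth : forall b : chart A,
    open (pdom `&` [set w | dom b (pfun w)]) /\
    smooth_on (pdom `&` [set w | dom b (pfun w)]) (fun w => coords b (pfun w));
  pfun_immersion : forall (b : chart A) w, pdom w -> dom b (pfun w) ->
    injective ('d (fun w' => coords b (pfun w')) w);
  pfun_open : forall O : set 'rV[R]_k, open O -> O `<=` pdom ->
    exists O' : set A, aopen O' /\ pfun @` O = O' `&` S
}.

End Manifolds.

Section Tensors.
Variables (R : realType) (n : nat).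

Definition bilin (B : 'M[R]_n) (X Y : 'rV[R]_n) : R := (X *m B *m Y^T) 0 0.

(* Local components, in each chart, of a tensor field with two indices. *)
Definition mxfield (A : atlas R n) := chart A -> 'rV[R]_n -> 'M[R]_n.

Variable A : atlas R n.

Definition tensor02 (B : mxfield A) : Prop :=
  (forall a, smooth_on (cimage a) (B a)) /\
  forall a b u, overlap a b u -> forall X Y,
    bilin (B a u) X Y =
    bilin (B b (transition a b u)) ('d (transition a b) u X) ('d (transition a b) u Y).

Definition tensor11 (T : mxfield A) : Prop :=
  (forall a, smooth_on (cimage a) (T a)) /\
  forall a b u, overlap a b u -> forall X,
    'd (transition a b) u (X *m T a u) = 'd (transition a b) u X *m T b (transition a b u).

Definition riemannian (g : mxfield A) : Prop :=
  tensor02 g /\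
  forall a u, cimage a u ->
    (forall X Y, bilin (g a u) X Y = bilin (g a u) Y X) /\
    (forall X, X != 0 -> 0 < bilin (g a u) X X).

End Tensors.

Section Connections.
Variables (R : realType) (n : nat).

(* [C u k] is the matrix of the Christoffel symbols (i, j) |-> Gamma^k_ij at u. *)
Definition christoffel := 'rV[R]_n -> 'I_n -> 'M[R]_n.

Definition chr (C : christoffel) (u X Y : 'rV[R]_n) : 'rV[R]_n :=
  \row_k bilin (C u k) X Y.

Definition covd (C : christoffel) (X Y : 'rV[R]_n -> 'rV[R]_n) :
    'rV[R]_n -> 'rV[R]_n :=
  fun u => 'D_(X u) Y u + chr C u (X u) (Y u).

Definition bracket (X Y : 'rV[R]_n -> 'rV[R]_n) : 'rV[R]_n -> 'rV[R]_n :=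
  fun u => 'D_(X u) Y u - 'D_(Y u) X u.

(* R(X,Y)Z; being tensorial, it may be computed on the fields with constant
   components X, Y, Z. *)
Definition curv (C : christoffel) (u X Y Z : 'rV[R]_n) : 'rV[R]_n :=
  let X' := fun=> X in let Y' := fun=> Y in let Z' := fun=> Z in
  covd C X' (covd C Y' Z') u - covd C Y' (covd C X' Z') u
  - covd C (bracket X' Y') Z' u.

(* The connection with Christoffel symbols C is torsion-free and makes the
   (possibly indefinite) metric h parallel on the coordinate domain U.  Both are
   tensorial conditions, tested on constant coordinate fields. *)
Definition levi_civita (U : set 'rV[R]_n)
    (h : 'rV[R]_n -> 'rV[R]_n -> 'rV[R]_n -> R) (C : christoffel) : Prop :=
  forall u, U u ->
    (forall X Y, chr C u X Y = chr C u Y X) /\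
    (forall Z X Y, 'D_Z (fun w => h w X Y) u =
                   h u (chr C u Z X) Y + h u X (chr C u Z Y)).

(* Covariant derivative along the curve c of the vector field V along c. *)
Definition covt (C : christoffel) (c V : R -> 'rV[R]_n) : R -> 'rV[R]_n :=
  fun t => derive1 V t + chr C (c t) (derive1 c t) (V t).

End Connections.

Section ParaKahlerNorden.
Variables (R : realType) (n : nat) (M : atlas R n).

(* A linear connection, by its Christoffel symbols in each chart.  Their
   transformation law is not required: it is only used for Levi-Civita
   connections, which are determined by the metric. *)
Definition connection := chart M -> christoffel R n.

Definition levi_civita_conn (g : mxfield M) (nab : connection) : Prop :=
  forall a, levi_civita (cimage a) (fun u => bilin (g a u)) (nab a).

Definition parallel11 (nab : connection) (phi : mxfield M) : Prop :=
  forall a u, cimage a u -> forall X Y : 'rV[R]_n -> 'rV[R]_n,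
    differentiable Y u ->
    covd (nab a) X (fun w => Y w *m phi a w) u = covd (nab a) X Y u *m phi a u.

Record para_kahler_norden (g phi : mxfield M) (nab : connection) : Prop := {
  pkn_riemannian : riemannian g;
  pkn_levi_civita : levi_civita_conn g nab;
  pkn_tensor : tensor11 phi;
  pkn_sq : forall a u, cimage a u -> phi a u *m phi a u = 1%:M;
  pkn_neq1 : ~ (forall a u, cimage a u -> phi a u = 1%:M);
  pkn_neqN1 : ~ (forall a u, cimage a u -> phi a u = - 1%:M);
  pkn_rank : forall a u, cimage a u ->
    \rank (eigenspace (phi a u) 1) = \rank (eigenspace (phi a u) (-1));
  pkn_pure : forall a u, cimage a u -> forall X Y,
    bilin (g a u) (X *m phi a u) Y = bilin (g a u) X (Y *m phi a u);
  pkn_parallel : parallel11 nab phi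
}.

End ParaKahlerNorden.

Section Sasaki.
Variables (R : realType) (n : nat) (M : atlas R n).
Variables (g phi : mxfield M) (nab : connection M).

(* Points and tangent vectors of TM in the chart of TM induced by a:
   z = (x, xi) and Z = (X, A). *)
Definition hlift (a : chart M) (z : 'rV[R]_(n + n)) (X : 'rV[R]_n) :
    'rV[R]_(n + n) :=
  row_mx X (- chr (nab a) (lsubmx z) X (rsubmx z)).

Definition vlift (X : 'rV[R]_n) : 'rV[R]_(n + n) := row_mx 0 X.

Definition hpart (Z : 'rV[R]_(n + n)) : 'rV[R]_n := lsubmx Z.

Definition vpart (a : chart M) (z Z : 'rV[R]_(n + n)) : 'rV[R]_n :=
  rsubmx Z + chr (nab a) (lsubmx z) (lsubmx Z) (rsubmx z).

Definition sasaki (a : chart M) (z Z Z' : 'rV[R]_(n + n)) : R :=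
  bilin (g a (lsubmx z)) (hpart Z) (hpart Z') +
  bilin (g a (lsubmx z)) (vpart a z Z) (vpart a z Z' *m phi a (lsubmx z)).

Definition hlift11 (F : mxfield M) (a : chart M) (z Z : 'rV[R]_(n + n)) :
    'rV[R]_(n + n) :=
  hlift a z (hpart Z *m F a (lsubmx z)) + vlift (vpart a z Z *m F a (lsubmx z)).

Lemma lift_decomp a z Z : Z = hlift a z (hpart Z) + vlift (vpart a z Z).
Proof.
by rewrite /hlift /vlift add_row_mx addr0 /vpart addrCA addNr addr0 hsubmxK.
Qed.

Lemma hpart_hlift a z X : hpart (hlift a z X) = X.
Proof. by rewrite /hpart row_mxKl. Qed.

Lemma hpart_vlift X : hpart (vlift X) = 0.
Proof. by rewrite /hpart row_mxKl. Qed.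

Lemma vpart_hlift a z X : vpart a z (hlift a z X) = 0.
Proof. by rewrite /vpart row_mxKr row_mxKl addNr. Qed.

Lemma vpart_vlift a z X : vpart a z (vlift X) = X.
Proof.
rewrite /vpart row_mxKr row_mxKl; apply/rowP => k.
by rewrite !mxE /bilin !mul0mx mxE addr0.
Qed.

Lemma sasaki_hh a z X Y :
  sasaki a z (hlift a z X) (hlift a z Y) = bilin (g a (lsubmx z)) X Y.
Proof. by rewrite /sasaki !hpart_hlift !vpart_hlift /bilin !mul0mx [X in _ + X]mxE addr0. Qed.

Lemma sasaki_hv a z X Y : sasaki a z (hlift a z X) (vlift Y) = 0.
Proof.
rewrite /sasaki hpart_vlift vpart_hlift /bilin !mul0mx trmx0 mulmx0.
by rewrite !mxE addr0.
Qed.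

Lemma sasaki_vv a z X Y :
  sasaki a z (vlift X) (vlift Y) =
  bilin (g a (lsubmx z)) X (Y *m phi a (lsubmx z)).
Proof. by rewrite /sasaki !hpart_vlift !vpart_vlift /bilin !mul0mx [X in X + _]mxE add0r. Qed.

Lemma hlift11_hlift F a z X :
  hlift11 F a z (hlift a z X) = hlift a z (X *m F a (lsubmx z)).
Proof. by rewrite /hlift11 hpart_hlift vpart_hlift mul0mx /vlift row_mx0 addr0. Qed.

Lemma hlift11_vlift F a z X :
  hlift11 F a z (vlift X) = vlift (X *m F a (lsubmx z)).
Proof.
rewrite /hlift11 hpart_vlift vpart_vlift mul0mx /hlift /vlift add_row_mx addr0.
congr row_mx; rewrite -[RHS]add0r; congr (_ + _); apply/rowP => k.
by rewrite !mxE /bilin !mul0mx mxE oppr0.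
Qed.

Definition unit_tbundle : set (tbundle M) :=
  [set p : tbundle M | forall a, dom a (base p) ->
    bilin (g a (coords a (base p))) (fiber p a)
          (fiber p a *m phi a (coords a (base p))) = 1].

(* The local parametrizations of the hypersurface T_1^phi M of TM. *)
Definition unit_param := lparam unit_tbundle (n + n).-1.

(* A connection on T_1^phi M, by its Christoffel symbols in each parametrization. *)
Definition unit_connection := unit_param -> christoffel R (n + n).-1.

(* Levi-Civita for the metric that sasaki induces on T_1^phi M. *)
Definition unit_levi_civita (nabh : unit_connection) : Prop :=
  forall (P : unit_param) (b : chart M),
    let q := fun w => coords (a := tbundle M) b (P w) in
    levi_civita (pdom P `&` [set w | dom (a := tbundle M) b (P w)])
      (fun w X Y => sasaki b (q w) ('d q w X) ('d q w Y))
      (nabh P).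

(* The covariant acceleration of Gam is computed in any parametrization P around
   Gam t, where Gam is represented by u, and pushed forward to TM. *)
Definition HF_geodesic (nabh : unit_connection) (F : mxfield M) (I : set R)
    (Gam : R -> tbundle M) : Prop :=
  forall t, I t ->
  forall (P : unit_param) (u : R -> 'rV[R]_((n + n).-1)) (J : set R),
    open J -> J t -> smooth_on J u ->
    (forall s, J s -> pdom P (u s) /\ P (u s) = Gam s) ->
  forall b : chart M, dom b (base (Gam t)) ->
    let c := fun s => coords (a := tbundle M) b (Gam s) in
    'd (fun w => coords (a := tbundle M) b (P w)) (u t)
       (covt (nabh P) u (derive1 u) t)
    = hlift11 F b (c t) (derive1 c t).

End Sasaki.

(* Main.v *)
(* In a chart, the connection of the hypersurface is known through Koszul's formula, so
   the covariant acceleration of Gamma paired with a tangent vector dq(Z) is the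
   Euler-Lagrange expression of the phi-Sasaki energy.  Metric compatibility and the
   symmetries of the curvature (pair symmetry for g, skewness for g and for the parallel
   form g(., phi .)) identify that expression as the pairing of dq(Z) with the vector of
   horizontal part gamma'' - R(xi', phi xi) gamma' and vertical part xi''.  The vertical
   lift of xi is a unit normal, because g(., phi .) is parallel; differentiating
   g(xi, phi xi) = 1 twice gives g(xi'', phi xi) = - g(xi', phi xi') = - rho^2, so the
   tangential part has vertical part xi'' + rho^2 xi.  Since tangent vectors and the normal
   span and the metric is nondegenerate, this determines the covariant acceleration, and
   the theorem compares horizontal and vertical parts.  To turn the equation of
   HF-geodesics, which quantifies over parametrizations, into pointwise equations, one
   needs a parametrization around each point: project radially an affine hyperplane of
   the fibre transverse to xi. *)
Require Import Defs.
From HB Require Import structures.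
From mathcomp Require Import all_boot all_order all_algebra.
From mathcomp Require Import all_classical all_reals all_analysis.
From mathcomp Require Import ring lra.
Set Implicit Arguments.
Unset Strict Implicit.
Unset Printing Implicit Defensive.
Import Order.TTheory GRing.Theory Num.Theory.
Import numFieldNormedType.Exports.
Local Open Scope classical_set_scope.
Local Open Scope ring_scope.


(** * Bilinear forms and Christoffel symbols *)

(** A connection is given here by bare Christoffel symbols subject to the pointwise Levi-Civita
    conditions, so even their differentiability has to be derived, by inverting [g] in Koszul's
    formula. On the hypersurface only these conditions are used: the second derivatives of the
    embedding in the direction of the test vector cancel by Schwarz's theorem, so no second
    fundamental form appears. The curvature term arises because differentiating xi along the curve
    and varying it in the direction alpha of a test vector do not commute: the commutator R(gamma',
    alpha) xi is paired with xi' by the form g(., phi .), and the symmetries of R exchange the two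
    pairs of arguments to produce R(xi', phi xi) gamma'. Since phi has both eigenvalues, the metric
    is indefinite on vertical vectors. Nondegeneracy is therefore obtained by testing against
    phi-images, where phi^2 = id brings back the positive form g, and the radial projection is
    defined only where g(xi, phi xi) > 0. The number rho^2 enters as the value of g(xi', phi xi') at
    a single time, so the whole comparison is pointwise in t. *)

Section BilinearForms.
Variables (R : realType) (n : nat).
Implicit Types (B : 'M[R]_n) (C : christoffel R n) (u X Y : 'rV[R]_n) (a : R).

Lemma bilinDl B X X' Y : bilin B (X + X') Y = bilin B X Y + bilin B X' Y.
Proof. by rewrite /bilin !mulmxDl mxE. Qed.

Lemma bilinDr B X Y Y' : bilin B X (Y + Y') = bilin B X Y + bilin B X Y'.
Proof. by rewrite /bilin linearD mulmxDr mxE. Qed.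

Lemma bilinNl B X Y : bilin B (- X) Y = - bilin B X Y.
Proof. by rewrite /bilin !mulNmx mxE. Qed.

Lemma bilinNr B X Y : bilin B X (- Y) = - bilin B X Y.
Proof. by rewrite /bilin linearN mulmxN mxE. Qed.

Lemma bilinZl B a X Y : bilin B (a *: X) Y = a * bilin B X Y.
Proof. by rewrite /bilin -!scalemxAl mxE. Qed.

Lemma bilinZr B a X Y : bilin B X (a *: Y) = a * bilin B X Y.
Proof. by rewrite /bilin linearZ -scalemxAr mxE. Qed.

Lemma bilin0l B Y : bilin B 0 Y = 0.
Proof. by rewrite /bilin !mul0mx mxE. Qed.

Lemma bilin0r B X : bilin B X 0 = 0.
Proof. by rewrite /bilin trmx0 mulmx0 mxE. Qed.

Lemma chrDl C u X X' Y :
  chr C u (X + X') Y = chr C u X Y + chr C u X' Y.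
Proof. by apply/rowP => k; rewrite !mxE bilinDl. Qed.

Lemma chrDr C u X Y Y' :
  chr C u X (Y + Y') = chr C u X Y + chr C u X Y'.
Proof. by apply/rowP => k; rewrite !mxE bilinDr. Qed.

Lemma chr0l C u Y : chr C u 0 Y = 0.
Proof. by apply/rowP => k; rewrite !mxE bilin0l. Qed.

Lemma chr0r C u X : chr C u X 0 = 0.
Proof. by apply/rowP => k; rewrite !mxE bilin0r. Qed.

Lemma chrZl C u a X Y : chr C u (a *: X) Y = a *: chr C u X Y.
Proof. by apply/rowP => k; rewrite !mxE bilinZl. Qed.

End BilinearForms.

(** * Derivatives *)

Section DerivRules.
Variable R : realType.
Implicit Types U V W : normedModType R.

(** Differentiability and a formula for all directional derivatives travel together, so that each
    calculus rule delivers both and nested rules compose as terms. *)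
Definition is_deriv V W (x : V) (f : V -> W) (L : V -> W) : Prop :=
  differentiable f x /\ forall v, 'D_v f x = L v.

Lemma is_derivP V W (x : V) (f : V -> W) :
  differentiable f x -> is_deriv x f (fun v => 'D_v f x).
Proof. by []. Qed.

Lemma is_deriv_diff V W (x : V) (f L : V -> W) v :
  is_deriv x f L -> 'd f x v = L v.
Proof. by move=> [df dfv]; rewrite -deriveE. Qed.

Lemma is_deriv_eq V W (x : V) (f L L' : V -> W) :
  is_deriv x f L -> L =1 L' -> is_deriv x f L'.
Proof. by move=> [df dfv] LL'; split=> // v; rewrite dfv LL'. Qed.

Lemma is_deriv_ext V W (x : V) (f f' L L' : V -> W) :
  is_deriv x f L -> f =1 f' -> L =1 L' -> is_deriv x f' L'.
Proof. by move=> df /funext<- /funext<-. Qed.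

(** The first-order expansion of [f] at [x] is also one of [g]; uniqueness of the differential then
    identifies ['d g x]. *)
Lemma differentiable_near V W (x : V) (f g : V -> W) :
  {near x, f =1 g} -> differentiable f x -> differentiable g x.
Proof.
move=> fg df; have fgx : f x = g x by exact: (nbhs_singleton fg).
have gE : g \o shift x = cst (g x) + 'd f x +o_ (0 : V) id.
  apply/eqaddoP => e e0; have /diff_locally/eqaddoP/(_ e e0) fE := df.
  have fg0 : \forall y \near (0 : V), f (y + x) = g (y + x).
    by move: fg; rewrite (near_shift 0) subr0.
  apply: filterS2 fE fg0 => y /= + fgy; by rewrite !fctE /= fgx fgy.
have gd : 'd g x = 'd f x :> (V -> W).
  by apply: (diff_unique _ gE); exact: diff_continuous.
by apply/diff_locallyP; rewrite gd; split=> //; exact: diff_continuous.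
Qed.

Lemma is_deriv_near V W (x : V) (f g L : V -> W) :
  {near x, f =1 g} -> is_deriv x f L -> is_deriv x g L.
Proof.
move=> fg [df dfv]; split=> [|v]; first exact: differentiable_near df.
by rewrite -(near_eq_derive v fg).
Qed.

Lemma is_deriv_cst V W (x : V) (a : W) : is_deriv x (fun=> a) (fun=> 0).
Proof.
split=> [|v]; first exact: differentiable_cst.
exact: derive_cst.
Qed.

Lemma is_deriv_id V (x : V) : is_deriv x (fun y => y) (fun v => v).
Proof.
split=> [|v]; last exact: derive_id.
by have [] := is_diff_id x.
Qed.

Lemma is_derivD V W (x : V) (f g Lf Lg : V -> W) :
  is_deriv x f Lf -> is_deriv x g Lg ->
  is_deriv x (fun y => f y + g y) (fun v => Lf v + Lg v).
Proof.
move=> [df dfv] [dg dgv]; split=> [|v]; first exact: differentiableD.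
by rewrite -dfv -dgv -deriveD//; exact: diff_derivable.
Qed.

Lemma is_deriv_sum V W (x : V) (I : Type) (r : seq I) (P : pred I)
    (f L : I -> V -> W) :
  (forall i, P i -> is_deriv x (f i) (L i)) ->
  is_deriv x (fun y => \sum_(i <- r | P i) f i y)
             (fun v => \sum_(i <- r | P i) L i v).
Proof.
move=> df; elim: r => [|i r IHr].
  by apply: is_deriv_ext (is_deriv_cst x 0) _ _ => y; rewrite big_nil.
have [Pi|nPi] := boolP (P i); last first.
  by apply: is_deriv_ext IHr _ _ => y; rewrite big_cons (negPf nPi).
by apply: is_deriv_ext (is_derivD (df i Pi) IHr) _ _ => y; rewrite big_cons Pi.
Qed.

Lemma differentiable_bigsum V W (x : V) (I : Type) (r : seq I) (P : pred I)
    (f : I -> V -> W) :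
  (forall i, P i -> differentiable (f i) x) ->
  differentiable (fun y => \sum_(i <- r | P i) f i y) x.
Proof.
by move=> df; have [] := is_deriv_sum r (fun i Pi => is_derivP (df i Pi)).
Qed.

Lemma is_derivM V (x : V) (f g Lf Lg : V -> R) :
  is_deriv x f Lf -> is_deriv x g Lg ->
  is_deriv x (fun y => f y * g y) (fun v => Lf v * g x + f x * Lg v).
Proof.
move=> [df dfv] [dg dgv]; split=> [|v]; first exact: differentiableM.
have := deriveM (diff_derivable (v := v) df) (diff_derivable (v := v) dg).
by rewrite dfv dgv addrC => ->; congr (_ + _); exact: mulrC.
Qed.

Lemma is_derivV V (x : V) (f L : V -> R) : f x != 0 ->
  is_deriv x f L -> is_deriv x (fun y => (f y)^-1) (fun v => - (f x) ^- 2 * L v).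
Proof.
move=> fx0 [df dfv]; split=> [|v]; first exact: differentiableV.
have := deriveV fx0 (diff_derivable (v := v) df).
by rewrite dfv.
Qed.

Lemma differentiable_bigprod V (x : V) (I : Type) (r : seq I) (P : pred I)
    (f : I -> V -> R) :
  (forall i, P i -> differentiable (f i) x) ->
  differentiable (fun y => \prod_(i <- r | P i) f i y) x.
Proof.
move=> df; elim: r => [|i r IHr].
  by under eq_fun do rewrite big_nil; exact: differentiable_cst.
under eq_fun do rewrite big_cons.
by case: (boolP (P i)) => // Pi; apply: differentiableM => //; exact: df.
Qed.

Lemma is_deriv_comp U V W (x : U) (f Lf : U -> V) (g Lg : V -> W) :
  is_deriv x f Lf -> is_deriv (f x) g Lg ->
  is_deriv x (fun y => g (f y)) (fun v => Lg (Lf v)).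
Proof.
move=> [df dfv] [dg dgv]; have dgf := differentiable_comp df dg.
split=> // v; rewrite -dgv -dfv !deriveE//.
by rewrite -[fun y => _]/(g \o f) diff_comp.
Qed.

Lemma is_deriv_coord V m n (x : V) (f L : V -> 'M[R]_(m, n)) i j :
  is_deriv x f L -> is_deriv x (fun y => f y i j) (fun v => L v i j).
Proof.
move=> [df dfv]; split=> [|v]; last first.
  by rewrite -dfv derive_mx ?mxE//; exact: diff_derivable.
exact: (differentiable_comp df (differentiable_coord (f x) i j)).
Qed.

Lemma differentiable_mx V m n (x : V) (f : V -> 'M[R]_(m, n)) :
  (forall i j, differentiable (fun y => f y i j) x) -> differentiable f x.
Proof.
move=> df.
have -> : f = fun y => \sum_i \sum_j f y i j *: delta_mx i j.
  by apply/funext => y; rewrite -matrix_sum_delta.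
by do 2 apply: differentiable_bigsum => ? _; exact: differentiableZl.
Qed.

Lemma is_deriv_mx V m n (x : V) (f L : V -> 'M[R]_(m, n)) :
  (forall i j, is_deriv x (fun y => f y i j) (fun v => L v i j)) ->
  is_deriv x f L.
Proof.
move=> df; have dfx : differentiable f x by apply: differentiable_mx => i j; have [] := df i j.
split=> // v; rewrite derive_mx; last exact: diff_derivable.
by apply/matrixP => i j; rewrite mxE; have [] := df i j.
Qed.

Lemma is_derivMx V m n p (x : V) (f Lf : V -> 'M[R]_(m, n)) (g Lg : V -> 'M[R]_(n, p)) :
  is_deriv x f Lf -> is_deriv x g Lg ->
  is_deriv x (fun y => f y *m g y) (fun v => Lf v *m g x + f x *m Lg v).
Proof.
move=> df dg; apply: is_deriv_mx => i j.
under eq_fun do rewrite mxE.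
apply: (@is_deriv_eq _ _ _ _ (fun v => \sum_k (Lf v i k * g x k j + f x i k * Lg v k j))).
  by apply: is_deriv_sum => k _; apply: is_derivM; exact: is_deriv_coord.
by move=> v; rewrite !mxE -big_split.
Qed.

Lemma is_derivT V m n (x : V) (f L : V -> 'M[R]_(m, n)) :
  is_deriv x f L -> is_deriv x (fun y => (f y)^T) (fun v => (L v)^T).
Proof.
move=> df; apply: is_deriv_mx => i j.
by apply: is_deriv_ext (is_deriv_coord _ _ df) _ _ => y; rewrite mxE.
Qed.

Lemma is_derivZ V m n (x : V) (k Lk : V -> R) (f L : V -> 'M[R]_(m, n)) :
  is_deriv x k Lk -> is_deriv x f L ->
  is_deriv x (fun y => k y *: f y) (fun v => Lk v *: f x + k x *: L v).
Proof.
move=> dk df; apply: is_deriv_mx => i j; under eq_fun do rewrite mxE.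
apply: is_deriv_eq (is_derivM dk (is_deriv_coord i j df)) _ => v.
by rewrite !mxE.
Qed.

Lemma is_deriv_lsubmx V m n1 n2 (x : V) (f L : V -> 'M[R]_(m, n1 + n2)) :
  is_deriv x f L -> is_deriv x (fun y => lsubmx (f y)) (fun v => lsubmx (L v)).
Proof.
move=> df; apply: is_deriv_mx => i j.
by apply: is_deriv_ext (is_deriv_coord _ _ df) _ _ => y; rewrite mxE.
Qed.

Lemma is_deriv_rsubmx V m n1 n2 (x : V) (f L : V -> 'M[R]_(m, n1 + n2)) :
  is_deriv x f L -> is_deriv x (fun y => rsubmx (f y)) (fun v => rsubmx (L v)).
Proof.
move=> df; apply: is_deriv_mx => i j.
by apply: is_deriv_ext (is_deriv_coord _ _ df) _ _ => y; rewrite mxE.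
Qed.

Lemma is_deriv_bilin V n (x : V) (B LB : V -> 'M[R]_n) (X LX Y LY : V -> 'rV[R]_n) :
  is_deriv x B LB -> is_deriv x X LX -> is_deriv x Y LY ->
  is_deriv x (fun y => bilin (B y) (X y) (Y y))
    (fun v => bilin (LB v) (X x) (Y x) + bilin (B x) (LX v) (Y x)
              + bilin (B x) (X x) (LY v)).
Proof.
move=> dB dX dY; rewrite /bilin.
apply: is_deriv_eq (is_deriv_coord _ _ (is_derivMx (is_derivMx dX dB) (is_derivT dY))) _.
by move=> v; rewrite mulmxDl !mxE [X in X + _ = _]addrC.
Qed.

Definition dchr n (C : christoffel R n) (u v X Y : 'rV[R]_n) : 'rV[R]_n :=
  \row_k bilin ('D_v (fun w => C w k) u) X Y.

Lemma is_deriv_chr V n (C : christoffel R n) (x : V) (c Lc X LX Y LY : V -> 'rV[R]_n) :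
  (forall k, differentiable (fun w => C w k) (c x)) ->
  is_deriv x c Lc -> is_deriv x X LX -> is_deriv x Y LY ->
  is_deriv x (fun y => chr C (c y) (X y) (Y y))
    (fun v => dchr C (c x) (Lc v) (X x) (Y x) + chr C (c x) (LX v) (Y x)
              + chr C (c x) (X x) (LY v)).
Proof.
move=> dC dc dX dY; apply: is_deriv_mx => i k; under eq_fun do rewrite mxE.
have dCk := is_deriv_comp dc (is_derivP (dC k)).
by apply: is_deriv_eq (is_deriv_bilin dCk dX dY) _ => v; rewrite !mxE.
Qed.

Lemma derive_chr n (C : christoffel R n) (u v X Y : 'rV[R]_n) :
  (forall k, differentiable (fun w => C w k) u) ->
  'D_v (fun w => chr C w X Y) u = dchr C u v X Y.
Proof.
move=> dC; have [_ ->] := is_deriv_chr dC (is_deriv_id u) (is_deriv_cst u X) (is_deriv_cst u Y).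
by rewrite chr0l chr0r !addr0.
Qed.

End DerivRules.


(** * Smooth maps *)

Section Smoothness.
Variable R : realType.
Implicit Types U V W : normedModType R.

(* [Ck] without the continuity clause at the last level: a notion of the same
   smooth maps for which the closure properties hold level by level. *)
Fixpoint Dk (k : nat) V W (A : set V) (f : V -> W) : Prop :=
  match k with
  | 0 => True
  | j.+1 => (forall x, A x -> differentiable f x) /\
            forall v, Dk j A (fun x => 'D_v f x)
  end.

Lemma smooth_onP V W (A : set V) (f : V -> W) :
  smooth_on A f <-> forall k, Dk k A f.
Proof.
split=> [sf k|df k].
  have := sf k; elim: k f {sf} => [//|k IHk] f [df dfv].
  by split=> // v; exact/IHk/dfv.
have := df k.+1; elim: k f {df} => [|k IHk] f [df dfv].
  by move=> x Ax; exact/differentiable_continuous/df.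
by split=> // v; exact/IHk/dfv.
Qed.

Lemma DkS k V W (A : set V) (f : V -> W) : Dk k.+1 A f -> Dk k A f.
Proof.
by elim: k f => [//|k IHk] f [df dfv]; split=> // v; exact/IHk/dfv.
Qed.

Lemma Dk_sub k V W (A B : set V) (f : V -> W) : B `<=` A -> Dk k A f -> Dk k B f.
Proof.
move=> BA; elim: k f => [//|k IHk] f [df dfv]; split=> [x /BA|v]; first exact: df.
exact/IHk/dfv.
Qed.

Lemma Dk_ext k V W (A : set V) (f g : V -> W) : open A ->
  (forall x, A x -> f x = g x) -> Dk k A f -> Dk k A g.
Proof.
move=> oA; elim: k f g => [//|k IHk] f g fg [df dfv].
have nfg x : A x -> {near x, f =1 g}.
  by move=> Ax; apply: filterS (open_nbhs_nbhs (conj oA Ax)) => y; exact: fg.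
split=> [x Ax|v]; first exact/(differentiable_near (nfg x Ax))/df.
by apply: IHk (dfv v) => x Ax; exact/near_eq_derive/nfg.
Qed.

(** The induction step shared by the closure properties below: a derivative formula valid on the
    open set, whose value in each fixed direction is already of class [k]. *)
Lemma Dk_is_deriv k V W (A : set V) (f : V -> W) (L : V -> V -> W) : open A ->
  (forall x, A x -> is_deriv x f (L x)) -> (forall v, Dk k A (fun x => L x v)) ->
  Dk k.+1 A f.
Proof.
move=> oA df dL; split=> [x /df[]//|v]; apply: Dk_ext (dL v) => // x Ax.
by have [_ ->] := df x Ax.
Qed.

Lemma Dk_cst k V W (A : set V) (a : W) : Dk k A (fun=> a).
Proof.
elim: k a => [//|k IHk] a; split=> [x _|v]; first exact: differentiable_cst.
have -> : (fun x : V => 'D_v (fun=> a) x) = fun=> 0; last exact: IHk.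
by apply/funext => x; exact: derive_cst.
Qed.

Lemma Dk_linear k V W (A : set V) (f L : V -> W) :
  (forall x, is_deriv x f L) -> Dk k A f.
Proof.
move=> df; case: k => [//|k]; split=> [x _|v]; first by have [] := df x.
have -> : (fun x : V => 'D_v f x) = fun=> L v; last exact: Dk_cst.
by apply/funext => x; have [_ ->] := df x.
Qed.

Lemma Dk_id k V (A : set V) : Dk k A (fun x => x).
Proof. by apply: Dk_linear => x; exact: is_deriv_id. Qed.

Lemma Dk_lin_comp k V W W' (A : set V) (f : V -> W) (h : W -> W') : open A ->
  (forall x, is_deriv x h h) -> Dk k A f -> Dk k A (fun x => h (f x)).
Proof.
move=> oA dh; elim: k f => [//|k IHk] f [df dfv].
apply: (Dk_is_deriv (L := fun x v => h ('D_v f x))) => // [x Ax|v]; last exact/IHk/dfv.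
exact: is_deriv_comp (is_derivP (df x Ax)) (dh (f x)).
Qed.

Lemma DkD k V W (A : set V) (f g : V -> W) : open A ->
  Dk k A f -> Dk k A g -> Dk k A (fun x => f x + g x).
Proof.
move=> oA; elim: k f g => [//|k IHk] f g [df dfv] [dg dgv].
apply: (Dk_is_deriv (L := fun x v => 'D_v f x + 'D_v g x)) => // [x Ax|v].
  by apply: is_derivD; [exact/is_derivP/df|exact/is_derivP/dg].
exact: (IHk _ _ (dfv v) (dgv v)).
Qed.

Lemma Dk_sum k V W (A : set V) (I : Type) (r : seq I) (f : I -> V -> W) : open A ->
  (forall i, Dk k A (f i)) -> Dk k A (fun x => \sum_(i <- r) f i x).
Proof.
move=> oA df; elim: r => [|i r IHr].
  by under eq_fun do rewrite big_nil; exact: Dk_cst.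
by under eq_fun do rewrite big_cons; exact: DkD.
Qed.

Lemma DkM k V (A : set V) (f g : V -> R) : open A ->
  Dk k A f -> Dk k A g -> Dk k A (fun x => f x * g x).
Proof.
move=> oA; elim: k f g => [//|k IHk] f g df' dg'.
have [[df dfv] [dg dgv]] := (df', dg').
apply: (Dk_is_deriv (L := fun x v => 'D_v f x * g x + f x * 'D_v g x)) => // [x Ax|v].
  by apply: is_derivM; [exact/is_derivP/df|exact/is_derivP/dg].
by apply: DkD => //; [exact: (IHk _ _ (dfv v) (DkS dg'))|exact: (IHk _ _ (DkS df') (dgv v))].
Qed.

Lemma Dk_coord k V m n (A : set V) (f : V -> 'M[R]_(m, n)) i j : open A ->
  Dk k A f -> Dk k A (fun x => f x i j).
Proof.
move=> oA; apply: (Dk_lin_comp (h := fun M : 'M[R]_(m, n) => M i j)) => // x.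
exact: is_deriv_coord (is_deriv_id _).
Qed.

Lemma Dk_mx k V m n (A : set V) (f : V -> 'M[R]_(m, n)) : open A ->
  (forall i j, Dk k A (fun x => f x i j)) -> Dk k A f.
Proof.
move=> oA; elim: k f => [//|k IHk] f df.
apply: (Dk_is_deriv (L := fun x v => \matrix_(i, j) 'D_v (fun y => f y i j) x)) => //.
  move=> x Ax; apply: is_deriv_mx => i j; split=> [|v]; last by rewrite mxE.
  by have [+ _] := df i j; exact.
move=> v; apply: IHk => i j; under eq_fun do rewrite mxE.
by have [_ +] := df i j; exact.
Qed.

Lemma DkMx k V m n p (A : set V) (f : V -> 'M[R]_(m, n)) (g : V -> 'M[R]_(n, p)) :
  open A -> Dk k A f -> Dk k A g -> Dk k A (fun x => f x *m g x).
Proof.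
move=> oA df dg; apply: Dk_mx => // i j; under eq_fun do rewrite mxE.
by apply: Dk_sum => // l; apply: DkM => //; exact: Dk_coord.
Qed.

Lemma DkT k V m n (A : set V) (f : V -> 'M[R]_(m, n)) : open A ->
  Dk k A f -> Dk k A (fun x => (f x)^T).
Proof.
move=> oA; apply: (Dk_lin_comp (h := fun M : 'M[R]_(m, n) => M^T)) => // x.
exact: is_derivT (is_deriv_id _).
Qed.

Lemma DkZ k V m n (A : set V) (a : V -> R) (f : V -> 'M[R]_(m, n)) : open A ->
  Dk k A a -> Dk k A f -> Dk k A (fun x => a x *: f x).
Proof.
move=> oA da df; apply: Dk_mx => // i j; under eq_fun do rewrite mxE.
by apply: DkM => //; exact: Dk_coord.
Qed.

Lemma Dk_lsubmx k V m n1 n2 (A : set V) (f : V -> 'M[R]_(m, n1 + n2)) : open A ->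
  Dk k A f -> Dk k A (fun x => lsubmx (f x)).
Proof.
move=> oA; apply: (Dk_lin_comp (h := @lsubmx R m n1 n2)) => // x.
exact: is_deriv_lsubmx (is_deriv_id _).
Qed.

Lemma Dk_rsubmx k V m n1 n2 (A : set V) (f : V -> 'M[R]_(m, n1 + n2)) : open A ->
  Dk k A f -> Dk k A (fun x => rsubmx (f x)).
Proof.
move=> oA; apply: (Dk_lin_comp (h := @rsubmx R m n1 n2)) => // x.
exact: is_deriv_rsubmx (is_deriv_id _).
Qed.

Lemma Dk_row_mx k V m n1 n2 (A : set V) (f : V -> 'M[R]_(m, n1))
    (g : V -> 'M[R]_(m, n2)) : open A ->
  Dk k A f -> Dk k A g -> Dk k A (fun x => row_mx (f x) (g x)).
Proof.
move=> oA df dg; apply: Dk_mx => // i j; case: (split_ordP j) => l ->.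
  by under eq_fun do rewrite row_mxEl; exact: Dk_coord.
by under eq_fun do rewrite row_mxEr; exact: Dk_coord.
Qed.

Lemma Dk_bilin k V n (A : set V) (B : V -> 'M[R]_n) (X Y : V -> 'rV[R]_n) : open A ->
  Dk k A B -> Dk k A X -> Dk k A Y -> Dk k A (fun x => bilin (B x) (X x) (Y x)).
Proof.
move=> oA dB dX dY.
exact: Dk_coord oA (DkMx oA (DkMx oA dX dB) (DkT oA dY)).
Qed.

Lemma row_sum_derive W n (f : 'rV[R]_n -> W) x v : differentiable f x ->
  'D_v f x = \sum_i v 0 i *: 'D_(delta_mx 0 i) f x.
Proof.
move=> df; rewrite deriveE// [v in LHS]row_sum_delta linear_sum.
by apply: eq_bigr => i _; rewrite linearZ deriveE.
Qed.

(** In the chain rule the direction ['D_v g x] varies with [x], whereas [Dk] controls fixed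
    directions only. Expanding it on the standard basis leaves products of components of ['D_v g]
    with partial derivatives of [f] along [g], to which induction applies. *)
Lemma Dk_comp_scalar k V p (A : set V) (B : set 'rV[R]_p) (g : V -> 'rV[R]_p)
    (f : 'rV[R]_p -> R) : open A -> (forall x, A x -> B (g x)) ->
  Dk k A g -> Dk k B f -> Dk k A (fun x => f (g x)).
Proof.
move=> oA AB; elim: k f => [//|k IHk] f dg' [df dfv].
have [dg dgv] := dg'.
apply: (Dk_is_deriv
  (L := fun x v => \sum_i ('D_v g x) 0 i * 'D_(delta_mx 0 i) f (g x))) => // [x Ax|v].
  have dfx := df _ (AB _ Ax).
  apply: is_deriv_eq (is_deriv_comp (is_derivP (dg x Ax)) (is_derivP dfx)) _ => v.
  by rewrite row_sum_derive.
apply: Dk_sum => // i; apply: DkM => //; first exact: Dk_coord oA (dgv v).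
exact: (IHk _ (DkS dg') (dfv (delta_mx 0 i))).
Qed.

Lemma Dk_comp k V p m n (A : set V) (B : set 'rV[R]_p) (g : V -> 'rV[R]_p)
    (f : 'rV[R]_p -> 'M[R]_(m, n)) : open A -> open B -> (forall x, A x -> B (g x)) ->
  Dk k A g -> Dk k B f -> Dk k A (fun x => f (g x)).
Proof.
move=> oA oB AB dg df; apply: Dk_mx => // i j.
exact: (Dk_comp_scalar (f := fun y => f y i j) oA AB dg (Dk_coord i j oB df)).
Qed.

Lemma DkV k V (A : set V) (f : V -> R) : open A -> (forall x, A x -> f x != 0) ->
  Dk k A f -> Dk k A (fun x => (f x)^-1).
Proof.
move=> oA f0; elim: k => [//|k IHk] df'; have [df dfv] := df'.
apply: (Dk_is_deriv (L := fun x v => - ((f x)^-1 * (f x)^-1) * 'D_v f x)) => // [x Ax|v].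
  apply: is_deriv_eq (is_derivV (f0 x Ax) (is_derivP (df x Ax))) _ => v.
  by rewrite expr2 invfM.
have dV : Dk k A (fun x => (f x)^-1) by exact/IHk/DkS.
under eq_fun do rewrite -mulN1r.
exact: DkM oA (DkM oA (Dk_cst _ _ _) (DkM oA dV dV)) (dfv v).
Qed.

(** The power -3/2 is written as the cube of the inverse square root itself, so that the induction
    proving its smoothness closes. *)
Lemma is_deriv_invsqrt V (x : V) (f L : V -> R) : 0 < f x -> is_deriv x f L ->
  is_deriv x (fun y => (Num.sqrt (f y))^-1)
    (fun v => - 2^-1 * ((Num.sqrt (f x))^-1) ^+ 3 * L v).
Proof.
move=> f0 df; have s0 : Num.sqrt (f x) != 0 by rewrite gt_eqF// sqrtr_gt0.
have dsqrt : is_deriv (f x) (Num.sqrt : R -> R) (fun r => r * (2 * Num.sqrt (f x))^-1).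
  have [dd ds] := is_derive1_sqrt f0.
  have dfx : differentiable (Num.sqrt : R -> R) (f x) by exact/derivable1_diffP.
  by split=> // r; rewrite deriveE// diff1E// derive1E ds.
apply: is_deriv_eq (is_derivV (f := fun y => Num.sqrt (f y)) s0 (is_deriv_comp df dsqrt)) _ => v.
by field.
Qed.

Lemma Dk_invsqrt k V (A : set V) (f : V -> R) : open A -> (forall x, A x -> 0 < f x) ->
  Dk k A f -> Dk k A (fun x => (Num.sqrt (f x))^-1).
Proof.
move=> oA f0; elim: k => [//|k IHk] df'; have [df dfv] := df'.
apply: (Dk_is_deriv (L := fun x v =>
   - 2^-1 * ((Num.sqrt (f x))^-1) ^+ 3 * 'D_v f x)) => // [x Ax|v].
  exact: is_deriv_invsqrt (f0 x Ax) (is_derivP (df x Ax)).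
have dV : Dk k A (fun x => (Num.sqrt (f x))^-1) by exact/IHk/DkS.
have dV3 : Dk k A (fun x => (Num.sqrt (f x))^-1 ^+ 3).
  by under eq_fun do rewrite !exprS expr0 mulr1; exact: DkM oA dV (DkM oA dV dV).
exact: DkM oA (DkM oA (Dk_cst _ _ _) dV3) (dfv v).
Qed.

Lemma is_derive_line V W (f : V -> W) (v y : V) (s : R) :
  differentiable f (s *: v + y) ->
  is_derive s 1 (fun r => f (r *: v + y)) ('D_v f (s *: v + y)).
Proof.
move=> df.
have dl : is_deriv s (fun r : R => r *: v + y) (fun r => r *: v + 0).
  apply: is_derivD; last exact: is_deriv_cst.
  have [dd dv] := is_diff_scalel s v; split=> // r.
  by rewrite deriveE// dv.
have [dd dv] := is_deriv_comp dl (is_derivP df).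
by split; [exact/derivable1_diffP|rewrite dv addr0 scale1r].
Qed.

(** The mean value theorem is applied in direction [v] to the increment of [f] along [h *: w], then
    in direction [w] to the resulting derivative. Up to reordering, the second difference is
    symmetric in [v] and [w], while the right-hand side is not. *)
Lemma second_difference_mvt V (A : set V) (f : V -> R) (x v w : V) (h : R) :
  0 <= h -> Dk 2 A f ->
  (forall s t, 0 <= s <= h -> 0 <= t <= h -> A (s *: v + (t *: w + x))) ->
  exists s t, [/\ 0 <= s <= h, 0 <= t <= h &
    f (h *: v + (h *: w + x)) - f (h *: v + x) - (f (h *: w + x) - f x) =
    'D_w (fun y => 'D_v f y) (s *: v + (t *: w + x)) * h * h].
Proof.
move=> h0 [df dfv] Ah.
have Ah0 s : 0 <= s <= h -> A (s *: v + x).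
  by move=> sh; have := Ah s 0 sh; rewrite lexx h0 scale0r add0r; exact.
have dphi s : 0 <= s <= h -> is_derive s 1
    (fun s => f (s *: v + (h *: w + x)) - f (s *: v + x))
    ('D_v f (s *: v + (h *: w + x)) - 'D_v f (s *: v + x)).
  move=> sh; have hh : 0 <= h <= h by rewrite h0 lexx.
  have d1 := is_derive_line (df _ (Ah s h sh hh)).
  have d2 := is_derive_line (df _ (Ah0 s sh)).
  exact: (is_deriveB d1 d2).
have [||s + sE] := MVT_segment h0 (df := fun s => 'D_v f (s *: v + (h *: w + x)) - 'D_v f (s *: v + x))
    (f := (fun s => f (s *: v + (h *: w + x)) - f (s *: v + x))).
- by move=> s; rewrite in_itv /= => /andP[s0 sh]; apply: dphi; rewrite !ltW.
- apply: derivable_within_continuous => s; rewrite in_itv /= => sh.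
  by have [] := dphi s sh.
rewrite in_itv /= => sh.
have dpsi t : 0 <= t <= h -> is_derive t 1 (fun t => 'D_v f (t *: w + (s *: v + x)))
    ('D_w (fun y => 'D_v f y) (t *: w + (s *: v + x))).
  move=> th; apply: is_derive_line; have [+ _] := dfv v; apply.
  by rewrite addrCA; exact: Ah.
have [||t + tE] := MVT_segment h0 (df := fun t => 'D_w (fun y => 'D_v f y) (t *: w + (s *: v + x)))
    (f := (fun t => 'D_v f (t *: w + (s *: v + x)))).
- by move=> t; rewrite in_itv /= => /andP[t0 th]; apply: dpsi; rewrite !ltW.
- apply: derivable_within_continuous => t; rewrite in_itv /= => th.
  by have [] := dpsi t th.
rewrite in_itv /= => th; exists s, t; split=> //.
move: sE tE; rewrite !scale0r !add0r !subr0 => ->.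
by rewrite !(addrCA (s *: v)) => ->.
Qed.

End Smoothness.


(** * Symmetry of second derivatives *)

Section Schwarz.
Variable R : realType.
Implicit Types V : normedModType R.

(** The same second difference, computed in both orders, equates the two mixed derivatives at nearby
    points; the third level of [Dk] makes both continuous at [x], so their values there differ by
    less than any [e]. *)
Lemma derive_derive_sym_scalar V (A : set V) (f : V -> R) (x v w : V) :
  open A -> A x -> Dk 3 A f ->
  'D_w (fun y => 'D_v f y) x = 'D_v (fun y => 'D_w f y) x.
Proof.
move=> oA Ax d3f; have d2f := DkS d3f.
have cont v' w' : {for x, continuous (fun z => 'D_w' (fun y => 'D_v' f y) z)}.
  have [_ /(_ v')[_ /(_ w')[dfx _]]] := d3f.
  exact/differentiable_continuous/dfx.
set a := LHS; set b := RHS.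
apply/eqP; rewrite -subr_eq0 -normr_le0; apply/ler_addgt0Pl => e e0; rewrite addr0.
have e20 : 0 < e / 2 by rewrite divr_gt0.
have nA : \forall z \near x, A z by exact: open_nbhs_nbhs.
have /cvgrPdist_lt/(_ _ e20) na := cont v w.
have /cvgrPdist_lt/(_ _ e20) nb := cont w v.
have /nbhs_ballP [d /= d0 dP] : nbhs x (A `&` ([set t | `|a - 'D_w (fun y => 'D_v f y) t| < e / 2]
    `&` [set t | `|b - 'D_v (fun y => 'D_w f y) t| < e / 2])).
  exact: (filterI nA (filterI na nb)).
(* With this [h] one has h (1 + |v| + |w|) = d / 2, which keeps every intermediate point in the ball
   of radius [d]; the summand 1 covers v = w = 0. *)
set h := d / (1 + `|v| + `|w|) / 2.
have nvw0 : 0 < 1 + `|v| + `|w| by rewrite -addrA ltr_pwDl.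
have h0 : 0 < h by rewrite !divr_gt0.
have hd s t v' w' : 0 <= s <= h -> 0 <= t <= h ->
    `|v'| + `|w'| = `|v| + `|w| -> ball x d (s *: v' + (t *: w' + x)).
  move=> /andP[s0 sh] /andP[t0 th] vwE; rewrite -ball_normE /ball_/=.
  rewrite addrA addrC opprD addNKr normrN.
  rewrite (le_lt_trans (ler_normD _ _))// !normrZ !ger0_norm//.
  apply: (@le_lt_trans _ _ (h * (`|v'| + `|w'|))).
    by rewrite mulrDr lerD// ler_wpM2r.
  have hE : h * (1 + `|v| + `|w|) = d / 2 by rewrite /h mulrAC divfK// gt_eqF.
  apply: (@le_lt_trans _ _ (d / 2)); last by rewrite ltr_pdivrMr// ltr_pMr// ltr1n.
  by rewrite -hE vwE -addrA; apply: ler_wpM2l; [exact: ltW|rewrite lerDr].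
have [a' ha E1] : exists2 a' : R, `|a - a'| < e / 2 &
    f (h *: v + (h *: w + x)) - f (h *: v + x) - (f (h *: w + x) - f x) = a' * h * h.
  have [|s [t [sh th E1]]] := second_difference_mvt (x := x) (v := v) (w := w) (ltW h0) d2f.
    by move=> s t sh th; have [] := dP _ (hd s t v w sh th erefl).
  exists ('D_w (fun y => 'D_v f y) (s *: v + (t *: w + x))); last exact: E1.
  by have [_ [ha _]] := dP _ (hd s t v w sh th erefl); exact: ha.
have [b' hb E2] : exists2 b' : R, `|b - b'| < e / 2 &
    f (h *: w + (h *: v + x)) - f (h *: w + x) - (f (h *: v + x) - f x) = b' * h * h.
  have [|s [t [sh th E2]]] := second_difference_mvt (x := x) (v := w) (w := v) (ltW h0) d2f.
    by move=> s t sh th; have [] := dP _ (hd s t w v sh th (addrC _ _)).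
  exists ('D_v (fun y => 'D_w f y) (s *: w + (t *: v + x))); last exact: E2.
  by have [_ [_ hb]] := dP _ (hd s t w v sh th (addrC _ _)); exact: hb.
move: ha hb; rewrite -/a -/b; move: (a : R) (b : R) => a0 b0 ha hb.
have sw (p q r z : R) : p - q - (r - z) = p - r - (q - z) by ring.
have abE : a' = b'.
  have hh0 : h * h != 0 by rewrite mulf_neq0// gt_eqF.
  clearbody h.
  have E : a' * h * h = b' * h * h.
    by rewrite -E1 -E2 [h *: w + (h *: v + x)]addrCA sw.
  by rewrite -!mulrA in E; exact: (mulIf hh0 E).
rewrite -abE in hb; have -> : a0 - b0 = (a0 - a') - (b0 - a').
  by rewrite opprB addrA subrK.
by rewrite (le_trans (ler_normB _ _))// (splitr e) lerD// ltW.
Qed.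

Lemma derive_derive_sym V m n (A : set V) (f : V -> 'M[R]_(m, n)) (x v w : V) :
  open A -> A x -> Dk 3 A f ->
  'D_w (fun y => 'D_v f y) x = 'D_v (fun y => 'D_w f y) x.
Proof.
move=> oA Ax df.
have E v' w' i j : ('D_w' (fun y => 'D_v' f y) x) i j =
    'D_w' (fun y => 'D_v' (fun z => f z i j) y) x.
  have [d1 /(_ v')[d2 _]] := df.
  rewrite derive_mx ?mxE; last exact/diff_derivable/d2.
  apply: near_eq_derive; apply: filterS (open_nbhs_nbhs (conj oA Ax)) => y Ay.
  by rewrite derive_mx ?mxE//; exact/diff_derivable/d1.
apply/matrixP => i j; apply: etrans (E v w i j) (etrans _ (esym (E w v i j))).
exact: (derive_derive_sym_scalar v w oA Ax (Dk_coord i j oA df)).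
Qed.

End Schwarz.


(** * Curvature *)

(* [ring] and [lra] compare atoms up to conversion, which diverges on derivatives. *)
Ltac gen_bilin :=
  repeat match goal with |- context [bilin ?B ?X ?Y] => generalize (bilin B X Y); intro end.

Section CurvatureSymmetries.
Variables (R : realType) (n : nat) (U : set 'rV[R]_n) (C : christoffel R n).
Hypothesis oU : open U.
Hypothesis C_diff : forall u, U u -> forall k, differentiable (fun w => C w k) u.
Hypothesis C_sym : forall u, U u -> forall X Y, chr C u X Y = chr C u Y X.
Implicit Types (u X Y Z W : 'rV[R]_n) (h : 'rV[R]_n -> 'M[R]_n).

Definition parallel02 h : Prop := forall u, U u -> forall Z X Y,
  'D_Z (fun w => bilin (h w) X Y) u =
  bilin (h u) (chr C u Z X) Y + bilin (h u) X (chr C u Z Y).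

Lemma derive_bilin_const h u X Y Z : differentiable h u ->
  'D_Z (fun w => bilin (h w) X Y) u = bilin ('D_Z h u) X Y.
Proof.
move=> dh; have [_ ->] := is_deriv_bilin (is_derivP dh) (is_deriv_cst u X) (is_deriv_cst u Y).
by rewrite bilin0l bilin0r !addr0.
Qed.

Lemma parallel02_derive h u X Y Z : parallel02 h -> U u -> differentiable h u ->
  bilin ('D_Z h u) X Y = bilin (h u) (chr C u Z X) Y + bilin (h u) X (chr C u Z Y).
Proof. by move=> hp Uu dh; rewrite -derive_bilin_const// hp. Qed.

Lemma curvE u X Y Z : U u -> curv C u X Y Z =
  dchr C u X Y Z - dchr C u Y X Z + chr C u X (chr C u Y Z) - chr C u Y (chr C u X Z).
Proof.
move=> Uu; rewrite /curv /bracket /covd.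
have E A B : 'D_A (fun w => 'D_B (fun=> Z) w + chr C w B Z) u = dchr C u A B Z.
  rewrite -derive_chr; last exact: C_diff.
  by under eq_fun do rewrite derive_cst add0r.
have dcst A B : 'D_A (fun=> B : 'rV[R]_n) u = 0 by exact: derive_cst.
rewrite (E X Y) (E Y X) (dcst X Y) (dcst Y X) (dcst Y Z) (dcst X Z).
rewrite (dcst (0 - 0) Z) subrr chr0l !add0r subr0.
by rewrite opprD addrACA addrA.
Qed.

Lemma curv_antisym u X Y Z : U u -> curv C u X Y Z = - curv C u Y X Z.
Proof.
move=> Uu; rewrite (curvE X Y)// (curvE Y X)//.
by rewrite !opprD !opprK [LHS]addrAC [- _ + _ in RHS]addrC -!addrA; congr (_ + (_ + _)); rewrite addrC.
Qed.

Lemma dchr_sym u v X Y : U u -> dchr C u v X Y = dchr C u v Y X.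
Proof.
move=> Uu; rewrite -!derive_chr; try exact: C_diff.
apply: near_eq_derive; apply: filterS (open_nbhs_nbhs (conj oU Uu)) => w Uw.
exact: C_sym.
Qed.

Lemma curv_bianchi u X Y Z : U u ->
  curv C u X Y Z + curv C u Y Z X + curv C u Z X Y = 0.
Proof.
move=> Uu; rewrite !curvE//.
rewrite (dchr_sym Y Z X)// (dchr_sym Z X Y)// (dchr_sym X Z Y)//.
rewrite (C_sym Uu Z X) (C_sym Uu Y X) (C_sym Uu Z Y).
move: (dchr _ _ X Y Z) (dchr _ _ Y X Z) (dchr _ _ Z Y X) => a b c.
move: (chr _ _ X (chr _ _ Y Z)) (chr _ _ Y (chr _ _ X Z)) (chr _ _ Z (chr _ _ X Y)).
by move=> a' b' c'; apply/rowP => k; rewrite !mxE; ring.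
Qed.

(** The mixed second derivatives of the function h(Z, W) commute. Expanded by parallelism, the
    products of two first-order terms are symmetric in X and Y and drop out; what remains is
    h(R(X,Y)Z, W) + h(Z, R(X,Y)W) = 0. It is applied both to the metric and to the form g(., phi
    .). *)
Lemma curv_skew h u X Y Z W : parallel02 h -> Dk 3 U h -> U u ->
  bilin (h u) (curv C u X Y Z) W = - bilin (h u) Z (curv C u X Y W).
Proof.
move=> hp dh Uu; have dhu : differentiable h u by have [+ _] := dh; exact.
have E A B : 'D_A (fun w => 'D_B (fun w' => bilin (h w') Z W) w) u =
    bilin (h u) (chr C u A (chr C u B Z)) W + bilin (h u) (chr C u B Z) (chr C u A W)
    + bilin (h u) (dchr C u A B Z) W
    + bilin (h u) (chr C u A Z) (chr C u B W) + bilin (h u) Z (chr C u A (chr C u B W))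
    + bilin (h u) Z (dchr C u A B W).
  have -> : 'D_A (fun w => 'D_B (fun w' => bilin (h w') Z W) w) u =
      'D_A (fun w => bilin (h w) (chr C w B Z) W + bilin (h w) Z (chr C w B W)) u.
    apply: near_eq_derive; apply: filterS (open_nbhs_nbhs (conj oU Uu)) => w Uw.
    exact: hp.
  have dc D := is_deriv_chr (C_diff Uu) (is_deriv_id u) (is_deriv_cst u B) (is_deriv_cst u D).
  have [_ ->] := is_derivD
    (is_deriv_bilin (is_derivP dhu) (dc Z) (is_deriv_cst u W))
    (is_deriv_bilin (is_derivP dhu) (is_deriv_cst u Z) (dc W)).
  rewrite !chr0l !chr0r !bilin0l !bilin0r !addr0 !parallel02_derive//; gen_bilin; ring.
have hZW : Dk 3 U (fun w => bilin (h w) Z W).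
  by apply: Dk_bilin => //; exact: Dk_cst.
have := etrans (esym (E X Y)) (etrans (derive_derive_sym_scalar Y X oU Uu hZW) (E Y X)).
have bl (B : 'M[R]_n) a b c d D : bilin B (a - b + c - d) D =
    bilin B a D - bilin B b D + bilin B c D - bilin B d D.
  by rewrite !bilinDl !bilinNl.
have br (B : 'M[R]_n) a b c d D : bilin B D (a - b + c - d) =
    bilin B D a - bilin B D b + bilin B D c - bilin B D d.
  by rewrite !bilinDr !bilinNr.
rewrite (curvE X Y Z Uu).
rewrite (curvE X Y W Uu).
rewrite bl.
rewrite br.
by gen_bilin; lra.
Qed.

Lemma curv_pair h u X Y Z W : parallel02 h -> Dk 3 U h -> U u ->
  (forall X Y, bilin (h u) X Y = bilin (h u) Y X) ->
  bilin (h u) (curv C u X Y Z) W = bilin (h u) (curv C u Z W X) Y.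
Proof.
move=> hp dh Uu hs; pose r A B D E := bilin (h u) (curv C u A B D) E.
have r12 A B D E : r A B D E = - r B A D E.
  by rewrite /r curv_antisym// bilinNl.
have r34 A B D E : r A B D E = - r A B E D.
  by rewrite /r curv_skew// hs.
have rb A B D E : r A B D E + r B D A E + r D A B E = 0.
  by rewrite /r -!bilinDl curv_bianchi// bilin0l.
change (r X Y Z W = r Z W X Y).
(* The four Bianchi identities of the classical octahedron argument. The two skew symmetries reduce
   their twelve terms to six components, and pair symmetry is a linear consequence. *)
move: (rb X Y Z W) (rb Y Z W X) (rb Z W X Y) (rb W X Y Z).
rewrite (r12 Z X Y W) (r34 Y Z W X) (r34 Z W Y X) (r12 W Y Z X) (r34 Y W Z X).
rewrite (r12 W X Z Y) (r34 X W Z Y) (r34 X Z W Y) (r12 W X Y Z) (r34 X Y W Z).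
move: (r X Y Z W) (r Y Z X W) (r X Z Y W) (r Z W X Y) (r Y W X Z) (r X W Y Z).
move=> {r r12 r34 rb} *; lra.
Qed.

End CurvatureSymmetries.

(** * Regularity of the Levi-Civita connection *)

Section LeviCivita.
Variables (R : realType) (n : nat) (U : set 'rV[R]_n) (C : christoffel R n).
Variable g : 'rV[R]_n -> 'M[R]_n.
Hypothesis oU : open U.
Hypothesis g_smooth : smooth_on U g.
Hypothesis g_sym : forall u, U u -> forall X Y, bilin (g u) X Y = bilin (g u) Y X.
Hypothesis g_pos : forall u, U u -> forall X, X != 0 -> 0 < bilin (g u) X X.
Hypothesis lcC : levi_civita U (fun u => bilin (g u)) C.

Lemma levi_civita_parallel : parallel02 U C g.
Proof. by move=> u Uu Z X Y; have [_ ->] := lcC Uu. Qed.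

(** For constant fields all brackets vanish, and the three metric identities obtained by permuting
    X, Y, Z are solved for one Christoffel term with the help of torsion-freeness. *)
Lemma koszul u X Y Z : U u -> bilin (g u) (chr C u X Y) Z =
  2^-1 * (bilin ('D_X g u) Y Z + bilin ('D_Y g u) X Z - bilin ('D_Z g u) X Y).
Proof.
move=> Uu; have [csym _] := lcC Uu.
have dg : differentiable g u by have /smooth_onP/(_ 1%N)[+ _] := g_smooth; exact.
rewrite (parallel02_derive Y Z X levi_civita_parallel Uu dg).
rewrite (parallel02_derive X Z Y levi_civita_parallel Uu dg).
rewrite (parallel02_derive X Y Z levi_civita_parallel Uu dg).
rewrite (csym Y X) (csym Z X) (csym Z Y) (g_sym Uu Y) (g_sym Uu X (chr C u Y Z)).
by rewrite (g_sym Uu (chr C u X Z)); gen_bilin; field.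
Qed.

Lemma posdef_unitmx u : U u -> g u \in unitmx.
Proof.
move=> Uu; rewrite -row_free_unit; apply/row_freeP.
have : kermx (g u) == 0.
  apply/eqP/row_matrixP => i; rewrite row0; apply/eqP; apply: contraT => ri0.
  have E : row i (kermx (g u)) *m g u = 0 by apply/sub_kermxP; exact: row_sub.
  by have := g_pos Uu ri0; rewrite /bilin E mul0mx mxE ltxx.
by rewrite kermx_eq0 => /row_freeP.
Qed.

Lemma differentiable_det m (V : normedModType R) (x : V) (A : V -> 'M[R]_m) :
  differentiable A x -> differentiable (fun y => \det (A y)) x.
Proof.
move=> dA; rewrite /determinant.
apply: differentiable_bigsum => s _.
apply: differentiableM; first exact: differentiable_cst.
apply: differentiable_bigprod => i _.
exact: (proj1 (is_deriv_coord _ _ (is_derivP dA))).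
Qed.

Lemma differentiable_invmx m (V : normedModType R) (x : V) (A : V -> 'M[R]_m) :
  (\near x, A x \in unitmx) -> differentiable A x ->
  differentiable (fun y => invmx (A y)) x.
Proof.
move=> Au dA.
(* Cramer's formula agrees with [invmx] only at invertible matrices, [invmx] being the identity
   elsewhere; hence the passage through a neighbourhood. *)
apply: (@differentiable_near _ _ _ _ (fun y => (\det (A y))^-1 *: \adj (A y))).
  by apply: filterS Au => y Ay; rewrite /invmx Ay.
have adj_diff : differentiable (fun y => \adj (A y)) x.
  apply: differentiable_mx => i j.
  have -> : (fun y => (\adj (A y)) i j) =
      fun y => (-1) ^+ (j + i) * \det (row' j (col' i (A y))).
    by apply/funext => y; rewrite mxE.
  apply: differentiableM; first exact: differentiable_cst.
  apply: differentiable_det; apply: differentiable_mx => k l.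
  have -> : (fun y => row' j (col' i (A y)) k l) = fun y => A y (lift j k) (lift i l).
    by apply/funext => y; rewrite !mxE.
  by have [] := is_deriv_coord (lift j k) (lift i l) (is_derivP dA).
have dd : differentiable (fun y => (\det (A y))^-1) x.
  apply: (differentiableV (differentiable_det dA)).
  by rewrite -unitfE -unitmxE; exact: nbhs_singleton Au.
by have [] := is_derivZ (is_derivP dd) (is_derivP adj_diff).
Qed.

(** [K w i j] collects the Christoffel symbols of the first kind, which Koszul's formula writes with
    first derivatives of [g]. Multiplying by the inverse metric recovers [C], so [C] is
    differentiable because [g] is smooth. *)
Lemma levi_civita_differentiable u k : U u -> differentiable (fun w => C w k) u.
Proof.
move=> Uu; pose e i : 'rV[R]_n := delta_mx 0 i.
pose K w (i j : 'I_n) : 'rV[R]_n := \row_l (2^-1 *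
  (bilin ('D_(e i) g w) (e j) (e l) + bilin ('D_(e j) g w) (e i) (e l)
   - bilin ('D_(e l) g w) (e i) (e j))).
have bilin_e w (i j : 'I_n) (B : 'rV[R]_n -> 'M[R]_n) : bilin (B w) (e i) (e j) = B w i j.
  by rewrite /bilin /e -rowE trmx_delta -colE !mxE.
have CE w : U w -> C w k = \matrix_(i, j) (K w i j *m invmx (g w)) 0 k.
  move=> Uw; apply/matrixP => i j; rewrite mxE.
  have -> : K w i j = chr C w (e i) (e j) *m g w.
    apply/rowP => l; rewrite mxE -koszul// /bilin.
    by rewrite [e l]/e trmx_delta -colE mxE.
  rewrite -mulmxA mulmxV ?posdef_unitmx// mulmx1 mxE.
  by rewrite (bilin_e w i j (fun w => C w k)).
have nU : \forall w \near u, U w by exact: open_nbhs_nbhs.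
apply: (@differentiable_near _ _ _ _
  (fun w => \matrix_(i, j) (K w i j *m invmx (g w)) 0 k)).
  by apply: filterS nU => w Uw; rewrite CE.
apply: differentiable_mx => i j; under eq_fun do rewrite mxE.
have /smooth_onP gs := g_smooth.
have dDg v : differentiable (fun w => 'D_v g w) u.
  by have [_ /(_ v)[+ _]] := gs 2%N; exact.
have dK : differentiable (fun w => K w i j) u.
  apply: differentiable_mx => i' l; under eq_fun do rewrite mxE.
  apply: differentiableM; first exact: differentiable_cst.
  apply: differentiableB; first apply: differentiableD.
  - by have [] := is_deriv_bilin (is_derivP (dDg (e i))) (is_deriv_cst u (e j)) (is_deriv_cst u (e l)).
  - by have [] := is_deriv_bilin (is_derivP (dDg (e j))) (is_deriv_cst u (e i)) (is_deriv_cst u (e l)).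
  - by have [] := is_deriv_bilin (is_derivP (dDg (e l))) (is_deriv_cst u (e i)) (is_deriv_cst u (e j)).
have dI : differentiable (fun w => invmx (g w)) u.
  apply: differentiable_invmx; first by apply: filterS nU => w; exact: posdef_unitmx.
  by have [+ _] := gs 1%N; exact.
by have [] := is_deriv_coord 0 k (is_derivMx (is_derivP dK) (is_derivP dI)).
Qed.

End LeviCivita.


(** * Euler-Lagrange equations *)

Section Curves.
Variable R : realType.

Lemma is_deriv_curve (W : normedModType R) (f : R -> W) t :
  differentiable f t -> is_deriv t f (fun r => r *: (derive1 f) t).
Proof. by move=> df; split=> // r; rewrite deriveE// diff1E. Qed.

Lemma is_deriv_derive1 (W : normedModType R) (f L : R -> W) t :
  is_deriv t f L -> (derive1 f) t = L 1.
Proof. by move=> [_ dfv]; rewrite derive1E dfv. Qed.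

Lemma near_eq_derive1 (W : normedModType R) (f g : R -> W) t :
  {near t, f =1 g} -> (derive1 f) t = (derive1 g) t.
Proof. by move=> fg; rewrite !derive1E; exact: near_eq_derive. Qed.

Lemma derive1_lsubmx n1 n2 (c : R -> 'rV[R]_(n1 + n2)) t : differentiable c t ->
  derive1 (fun s => lsubmx (c s)) t = lsubmx ((derive1 c) t).
Proof.
move=> dc; rewrite (is_deriv_derive1 (is_deriv_lsubmx (is_deriv_curve dc))).
by rewrite scale1r.
Qed.

Lemma derive1_rsubmx n1 n2 (c : R -> 'rV[R]_(n1 + n2)) t : differentiable c t ->
  derive1 (fun s => rsubmx (c s)) t = rsubmx ((derive1 c) t).
Proof.
move=> dc; rewrite (is_deriv_derive1 (is_deriv_rsubmx (is_deriv_curve dc))).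
by rewrite scale1r.
Qed.

Lemma derive1_bilin_parallel n (U : set 'rV[R]_n) (C : christoffel R n)
    (h : 'rV[R]_n -> 'M[R]_n) (c V W : R -> 'rV[R]_n) t :
  parallel02 U C h -> U (c t) -> differentiable h (c t) ->
  differentiable c t -> differentiable V t -> differentiable W t ->
  derive1 (fun s => bilin (h (c s)) (V s) (W s)) t =
  bilin (h (c t)) (covt C c V t) (W t) + bilin (h (c t)) (V t) (covt C c W t).
Proof.
move=> hp Uc dh dc dV dW.
rewrite (is_deriv_derive1 (is_deriv_bilin (is_deriv_comp (is_deriv_curve dc) (is_derivP dh))
  (is_deriv_curve dV) (is_deriv_curve dW))).
rewrite !scale1r (parallel02_derive _ _ _ hp Uc dh) /covt !bilinDl !bilinDr.
by gen_bilin; ring.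
Qed.

Lemma differentiable_covt n (C : christoffel R n) (c V : R -> 'rV[R]_n) t :
  (forall k, differentiable (fun w => C w k) (c t)) ->
  differentiable c t -> differentiable (derive1 c) t ->
  differentiable V t -> differentiable (derive1 V) t ->
  differentiable (covt C c V) t.
Proof.
move=> dC dc dc1 dV dV1.
by have [] := is_derivD (is_derivP dV1)
  (is_deriv_chr dC (is_derivP dc) (is_derivP dc1) (is_derivP dV)).
Qed.

End Curves.

(** * The energy of a Sasaki-type metric in one chart *)

Section SasakiLocal.
Variables (R : realType) (n : nat) (U : set 'rV[R]_n) (C : christoffel R n).
Variables (g b : 'rV[R]_n -> 'M[R]_n).

(* [vcomp] and [sas] are [vpart] and [sasaki] in one chart, for an arbitrary
   vertical form [b]. *)
Definition vcomp (z Z : 'rV[R]_(n + n)) : 'rV[R]_n :=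
  rsubmx Z + chr C (lsubmx z) (lsubmx Z) (rsubmx z).

Definition sas (z Z Z' : 'rV[R]_(n + n)) : R :=
  bilin (g (lsubmx z)) (lsubmx Z) (lsubmx Z') +
  bilin (b (lsubmx z)) (vcomp z Z) (vcomp z Z').

Hypothesis oU : open U.
Hypothesis C_diff : forall u, U u -> forall k, differentiable (fun w => C w k) u.
Hypothesis C_sym : forall u, U u -> forall X Y, chr C u X Y = chr C u Y X.
Hypothesis g_par : parallel02 U C g.
Hypothesis b_par : parallel02 U C b.
Hypothesis g_smooth : Dk 3 U g.
Hypothesis b_smooth : Dk 3 U b.
Hypothesis g_sym : forall u, U u -> forall X Y, bilin (g u) X Y = bilin (g u) Y X.
Hypothesis b_sym : forall u, U u -> forall X Y, bilin (b u) X Y = bilin (b u) Y X.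

Lemma is_deriv_lsubmx_id z : is_deriv z (@lsubmx R 1 n n) lsubmx.
Proof. exact: is_deriv_lsubmx (is_deriv_id z). Qed.

Lemma is_deriv_rsubmx_id z : is_deriv z (@rsubmx R 1 n n) rsubmx.
Proof. exact: is_deriv_rsubmx (is_deriv_id z). Qed.

Lemma is_deriv_vcomp z Z : U (lsubmx z) ->
  is_deriv z (fun w => vcomp w Z)
    (fun v => dchr C (lsubmx z) (lsubmx v) (lsubmx Z) (rsubmx z)
              + chr C (lsubmx z) (lsubmx Z) (rsubmx v)).
Proof.
move=> Uz; apply: is_deriv_eq (is_derivD (is_deriv_cst z (rsubmx Z))
  (is_deriv_chr (C_diff Uz) (is_deriv_lsubmx_id z) (is_deriv_cst z (lsubmx Z))
     (is_deriv_rsubmx_id z))) _ => v.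
by rewrite chr0l addr0 add0r.
Qed.

Lemma is_deriv_sas z Z Z' : U (lsubmx z) ->
  is_deriv z (fun w => sas w Z Z') (fun v =>
    bilin ('D_(lsubmx v) g (lsubmx z)) (lsubmx Z) (lsubmx Z') +
    (bilin ('D_(lsubmx v) b (lsubmx z)) (vcomp z Z) (vcomp z Z') +
     bilin (b (lsubmx z)) (dchr C (lsubmx z) (lsubmx v) (lsubmx Z) (rsubmx z)
              + chr C (lsubmx z) (lsubmx Z) (rsubmx v)) (vcomp z Z') +
     bilin (b (lsubmx z)) (vcomp z Z) (dchr C (lsubmx z) (lsubmx v) (lsubmx Z') (rsubmx z)
              + chr C (lsubmx z) (lsubmx Z') (rsubmx v)))).
Proof.
move=> Uz; have [dg _] := g_smooth; have [db _] := b_smooth.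
have Dg := is_deriv_comp (is_deriv_lsubmx_id z) (is_derivP (dg _ Uz)).
have Db := is_deriv_comp (is_deriv_lsubmx_id z) (is_derivP (db _ Uz)).
apply: is_deriv_eq (is_derivD
  (is_deriv_bilin Dg (is_deriv_cst z (lsubmx Z)) (is_deriv_cst z (lsubmx Z')))
  (is_deriv_bilin Db (is_deriv_vcomp Z Uz) (is_deriv_vcomp Z' Uz))) _ => v.
by rewrite bilin0l bilin0r !addr0.
Qed.

(* The left-hand side is the Euler-Lagrange expression of the energy of [c], tested
   on [Z]; reading off the right-hand side gives the horizontal and vertical parts of
   the covariant acceleration in TM without computing the connection of TM. *)
Lemma sas_euler_lagrange (phi : 'M[R]_n) (c : R -> 'rV[R]_(n + n)) t
    (gam := fun s => lsubmx (c s)) (xi := fun s => rsubmx (c s)) Z :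
  U (gam t) -> (\near t, differentiable c t) -> differentiable (derive1 c) t ->
  (forall X Y, bilin (b (gam t)) X Y = bilin (g (gam t)) X (Y *m phi)) ->
  derive1 (fun s => sas (c s) ((derive1 c) s) Z) t
    - 2^-1 * 'D_Z (fun z => sas z ((derive1 c) t) ((derive1 c) t)) (c t) =
  bilin (g (gam t)) (covt C gam (derive1 gam) t
     - curv C (gam t) (covt C gam xi t) (xi t *m phi) ((derive1 gam) t)) (lsubmx Z) +
  bilin (b (gam t)) (covt C gam (covt C gam xi) t) (vcomp (c t) Z).
Proof.
move=> Ut nc dc1 bE; have dc : differentiable c t by exact: nbhs_singleton nc.
have [dg _] := g_smooth; have [db _] := b_smooth.
have dgam : differentiable gam t by have [] := is_deriv_lsubmx (is_derivP dc).
have dxi : differentiable xi t by have [] := is_deriv_rsubmx (is_derivP dc).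
have gamE : {near t, (fun s => lsubmx ((derive1 c) s)) =1 (derive1 gam)}.
  by apply: filterS nc => s dcs; rewrite /gam derive1_lsubmx.
have xiE : {near t, (fun s => rsubmx ((derive1 c) s)) =1 (derive1 xi)}.
  by apply: filterS nc => s dcs; rewrite /xi derive1_rsubmx.
have dgam1 : differentiable (derive1 gam) t.
  by apply: differentiable_near gamE _; have [] := is_deriv_lsubmx (is_derivP dc1).
have dxi1 : differentiable (derive1 xi) t.
  by apply: differentiable_near xiE _; have [] := is_deriv_rsubmx (is_derivP dc1).
have vcE : {near t, (fun s => vcomp (c s) ((derive1 c) s)) =1 covt C gam xi}.
  by near=> s; rewrite /vcomp /covt (near gamE s) // (near xiE s).
have dv : differentiable (covt C gam xi) t by exact: differentiable_covt (C_diff Ut) _ _ _ _.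
pose al := lsubmx Z; pose be := rsubmx Z.
(* [eta] is the vertical part along the curve of the vector field on TM with constant components
   [Z]. It varies although [Z] does not, and its covariant derivative brings in the derivatives of
   the Christoffel symbols. *)
pose eta := fun s => be + chr C (gam s) al (xi s).
have Deta := is_derivD (is_deriv_cst t be) (is_deriv_chr (C_diff Ut) (is_deriv_curve dgam)
  (is_deriv_cst t al) (is_deriv_curve dxi)).
have deta : differentiable eta t by have [] := Deta.
have eta1 : (derive1 eta) t = dchr C (gam t) ((derive1 gam) t) al (xi t) + chr C (gam t) al ((derive1 xi) t).
  by rewrite (is_deriv_derive1 Deta) !scale1r chr0l addr0 add0r.
have -> : derive1 (fun s => sas (c s) ((derive1 c) s) Z) t =
    bilin (g (gam t)) (covt C gam (derive1 gam) t) al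
    + bilin (g (gam t)) ((derive1 gam) t) (chr C (gam t) ((derive1 gam) t) al)
    + (bilin (b (gam t)) (covt C gam (covt C gam xi) t) (eta t)
       + bilin (b (gam t)) (covt C gam xi t) (covt C gam eta t)).
  have sE : {near t, (fun s => sas (c s) ((derive1 c) s) Z) =1
     (fun s => bilin (g (gam s)) ((derive1 gam) s) al + bilin (b (gam s)) (covt C gam xi s) (eta s))}.
    by near=> s; rewrite /sas (near gamE s)// (near vcE s).
  rewrite (near_eq_derive1 sE).
  have dgc := is_deriv_bilin (is_deriv_comp (is_derivP dgam) (is_derivP (dg _ Ut)))
    (is_derivP dgam1) (is_deriv_cst t al).
  have dbc := is_deriv_bilin (is_deriv_comp (is_derivP dgam) (is_derivP (db _ Ut)))
    (is_derivP dv) (is_derivP deta).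
  rewrite (is_deriv_derive1 (is_derivD (is_deriv_curve (proj1 dgc)) (is_deriv_curve (proj1 dbc)))).
  rewrite !scale1r (derive1_bilin_parallel g_par Ut (dg _ Ut) dgam dgam1 (differentiable_cst _ _)).
  rewrite (derive1_bilin_parallel b_par Ut (db _ Ut) dgam dv deta).
  by rewrite [covt C gam (cst al) t]/covt derive1_cst add0r.
have [_ ->] := is_deriv_sas ((derive1 c) t) ((derive1 c) t) Ut.
have -> : lsubmx (derive1 c t) = derive1 gam t by exact: (nbhs_singleton gamE).
have -> : vcomp (c t) (derive1 c t) = covt C gam xi t by exact: (nbhs_singleton vcE).
have -> : vcomp (c t) Z = eta t by [].
have covt_eta : covt C gam eta t = dchr C (gam t) (derive1 gam t) al (xi t)
    + chr C (gam t) al (derive1 xi t) + chr C (gam t) (derive1 gam t) (eta t).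
  by rewrite /covt eta1.
have vE : covt C gam xi t = derive1 xi t + chr C (gam t) (derive1 gam t) (xi t) by [].
rewrite covt_eta -/al -/be -/(gam t) -/(xi t).
rewrite (parallel02_derive _ _ _ g_par Ut (dg _ Ut)) (parallel02_derive _ _ _ b_par Ut (db _ Ut)).
(* Pair symmetry for [g] moves the curvature to R(gamma', alpha) acting on xi', [bE] trades g(., phi
   xi) for b(., xi), and skewness for [b] transfers the operator to xi. In this form it matches the
   commutator produced by [eta]. *)
have curvb : bilin (g (gam t))
      (curv C (gam t) (covt C gam xi t) (xi t *m phi) (derive1 gam t)) al =
    - bilin (b (gam t)) (covt C gam xi t) (curv C (gam t) (derive1 gam t) al (xi t)).
  rewrite (curv_pair oU C_diff C_sym _ _ _ _ g_par)//; last exact: g_sym.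
  by rewrite -bE (curv_skew oU C_diff _ _ _ _ b_par).
rewrite (bilinDl _ (covt C gam (derive1 gam) t)) bilinNl curvb opprK (curvE C_diff _ _ _ Ut).
have etaE : eta t = be + chr C (gam t) al (xi t) by [].
rewrite etaE (chrDr _ _ _ be).
(* Only the occurrence of xi' under [chr C _ al] needs expanding; elsewhere it stays opaque, and the
   remaining cancellation is linear. *)
move: (covt C gam xi t) vE => v vE.
have -> : chr C (gam t) al v =
    chr C (gam t) al (derive1 xi t) + chr C (gam t) al (chr C (gam t) (derive1 gam t) (xi t)).
  by rewrite vE chrDr.
rewrite (g_sym Ut (chr C (gam t) al (derive1 gam t)) (derive1 gam t)) (C_sym Ut al (derive1 gam t)).
move: (covt C gam (derive1 gam) t) (covt C gam (covt C gam xi) t) => g2 x2.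
move: (chr C (gam t) al (chr C (gam t) (derive1 gam t) (xi t))) => w1.
move: (chr C (gam t) (derive1 gam t) (chr C (gam t) al (xi t))) => w2.
move: (dchr _ _ (derive1 gam t) al _) (dchr _ _ al (derive1 gam t) _) => d1 d2.
move: (chr C (gam t) al (derive1 xi t)) (chr C (gam t) (derive1 gam t) be) => w3 w4.
move: (chr C (gam t) (derive1 gam t) al) (be + chr C (gam t) al (xi t)) => w5 w6.
rewrite (b_sym Ut (d2 + w4)) (b_sym Ut (w3 + w1)).
rewrite !bilinDr !bilinNr; gen_bilin; lra.
Unshelve. all: by end_near. Qed.

End SasakiLocal.


(** * The Levi-Civita connection of an induced metric *)

Section InducedMetric.
Variables (R : realType) (k N : nat) (W : set 'rV[R]_k) (q : 'rV[R]_k -> 'rV[R]_N).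
Variables (G : 'rV[R]_N -> 'M[R]_N) (Ch : christoffel R k).
Hypothesis oW : open W.
Hypothesis q_smooth : Dk 3 W q.
Hypothesis G_diff : forall w, W w -> differentiable G (q w).
Hypothesis G_sym : forall w, W w -> forall X Y, bilin (G (q w)) X Y = bilin (G (q w)) Y X.
Hypothesis lcCh :
  levi_civita W (fun w X Y => bilin (G (q w)) ('d q w X) ('d q w Y)) Ch.

(** The Jacobian of [q] as a matrix-valued function of [w], so that it can be differentiated in its
    turn: [A *m 'D_B dmx w] is the second derivative of [q] in the directions A and B. *)
Definition dmx (w : 'rV[R]_k) : 'M[R]_(k, N) :=
  \matrix_(i, j) ('D_(delta_mx 0 i) q w) 0 j.

Lemma diff_dmx w v : W w -> 'd q w v = v *m dmx w.
Proof.
move=> Ww; have [dq _] := q_smooth.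
rewrite -deriveE; last exact: dq.
rewrite row_sum_derive; last exact: dq.
by apply/rowP => j; rewrite summxE !mxE; apply: eq_bigr => i _; rewrite !mxE.
Qed.

Lemma is_deriv_dmx w : W w -> is_deriv w q (fun v => v *m dmx w).
Proof.
move=> Ww; have [dq _] := q_smooth.
by split=> [|v]; [exact: dq|rewrite deriveE ?diff_dmx//; exact: dq].
Qed.

Lemma differentiable_dmx w : W w -> differentiable dmx w.
Proof.
move=> Ww; apply: differentiable_mx => i j; under eq_fun do rewrite mxE.
have [_ /(_ (delta_mx 0 i))[dq _]] := q_smooth.
exact: (proj1 (is_deriv_coord 0 j (is_derivP (dq _ Ww)))).
Qed.

Lemma derive_dmx_sym w A B : W w -> A *m 'D_B dmx w = B *m 'D_A dmx w.
Proof.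
move=> Ww; have [dq _] := q_smooth.
have E X Y : 'D_X (fun w => 'D_Y q w) w = Y *m 'D_X dmx w.
  have -> : 'D_X (fun w => 'D_Y q w) w = 'D_X (fun w => Y *m dmx w) w.
    apply: near_eq_derive; apply: filterS (open_nbhs_nbhs (conj oW Ww)) => w' Ww'.
    by have [_ ->] := is_deriv_dmx Ww'.
  have [_ ->] := is_derivMx (is_deriv_cst w Y) (is_derivP (differentiable_dmx Ww)).
  by rewrite mul0mx add0r.
rewrite -(E B A) -(E A B).
exact: (derive_derive_sym A B oW Ww q_smooth).
Qed.

(** Metric compatibility for (X; X, Z) minus half of it for (Z; X, X). The Christoffel terms in (X,
    Z) cancel by torsion-freeness and the Hessian terms in (X, Z) by Schwarz, leaving only the
    Hessian of [q] in (X, X). *)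
Lemma induced_koszul w (X Z : 'rV[R]_k) (dX : 'M[R]_(k, N)) (gX gZ : 'M[R]_N) : W w ->
  'D_X dmx w = dX -> 'D_(X *m dmx w) G (q w) = gX -> 'D_(Z *m dmx w) G (q w) = gZ ->
  bilin (G (q w)) (chr Ch w X X *m dmx w) (Z *m dmx w) =
  bilin gX (X *m dmx w) (Z *m dmx w)
  + bilin (G (q w)) (X *m dX) (Z *m dmx w)
  - 2^-1 * bilin gZ (X *m dmx w) (X *m dmx w).
Proof.
move=> Ww dXE gXE gZE; have [csym met] := lcCh Ww.
have E (A B D : 'rV[R]_k) (dA : 'M[R]_(k, N)) (gA : 'M[R]_N) :
    'D_A dmx w = dA -> 'D_(A *m dmx w) G (q w) = gA ->
    'D_A (fun v => bilin (G (q v)) ('d q v B) ('d q v D)) w =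
    bilin gA (B *m dmx w) (D *m dmx w)
    + bilin (G (q w)) (B *m dA) (D *m dmx w)
    + bilin (G (q w)) (B *m dmx w) (D *m dA).
  move=> <- <-.
  have -> : 'D_A (fun v => bilin (G (q v)) ('d q v B) ('d q v D)) w =
            'D_A (fun v => bilin (G (q v)) (B *m dmx v) (D *m dmx v)) w.
    apply: near_eq_derive; apply: filterS (open_nbhs_nbhs (conj oW Ww)) => w' Ww'.
    by rewrite !diff_dmx.
  have DB (Y : 'rV[R]_k) := is_derivMx (is_deriv_cst w Y) (is_derivP (differentiable_dmx Ww)).
  have [_ ->] := is_deriv_bilin
    (is_deriv_comp (is_deriv_dmx Ww) (is_derivP (G_diff Ww))) (DB B) (DB D).
  by rewrite !mul0mx !add0r.
have met' (A B D : 'rV[R]_k) : 'D_A (fun v => bilin (G (q v)) ('d q v B) ('d q v D)) w =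
    bilin (G (q w)) (chr Ch w A B *m dmx w) (D *m dmx w)
    + bilin (G (q w)) (B *m dmx w) (chr Ch w A D *m dmx w).
  by rewrite met !diff_dmx.
have [dZ dZE] : exists dZ : 'M[R]_(k, N), 'D_Z dmx w = dZ by eexists.
have S : X *m dZ = Z *m dX by rewrite -dXE -dZE; exact: derive_dmx_sym.
have H1 := etrans (esym (E X X Z dX gX dXE gXE)) (met' X X Z).
have H2 := etrans (esym (E Z X X dZ gZ dZE gZE)) (met' Z X X).
rewrite -S in H1; rewrite csym in H2.
rewrite (G_sym Ww (chr Ch w X Z *m dmx w) (X *m dmx w)) in H2.
rewrite (G_sym Ww (X *m dZ) (X *m dmx w)) in H2.
by move: H1 H2; gen_bilin; lra.
Qed.

(* Koszul's formula for the induced metric along [c' = dq u'] involves only the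
   ambient metric, so no ambient connection is needed. *)
Lemma induced_euler_lagrange (u : R -> 'rV[R]_k) t Z :
  W (u t) -> (\near t, differentiable u t) -> differentiable (derive1 u) t ->
  let c := fun s => q (u s) in
  bilin (G (c t)) ('d q (u t) (covt Ch u (derive1 u) t)) ('d q (u t) Z) =
  derive1 (fun s => bilin (G (c s)) (derive1 c s) ('d q (u t) Z)) t
  - 2^-1 * 'D_('d q (u t) Z) (fun z => bilin (G z) (derive1 c t) (derive1 c t)) (c t).
Proof.
move=> Wt nu du1 c; have [dq _] := q_smooth.
have du : differentiable u t by exact: nbhs_singleton nu.
have nW : \forall s \near t, W (u s).
  have uc : {for t, continuous u} by exact: differentiable_continuous.
  by apply: uc; exact: open_nbhs_nbhs.
have c1E : {near t, derive1 c =1 (fun s => derive1 u s *m dmx (u s))}.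
  apply: filterS2 nu nW => s dus Ws.
  rewrite (is_deriv_derive1 (is_deriv_comp (is_deriv_curve dus) (is_deriv_dmx Ws))).
  by rewrite scale1r.
have Dc1 := is_derivMx (is_deriv_curve du1)
  (is_deriv_comp (is_deriv_curve du) (is_derivP (differentiable_dmx Wt))).
have dc1 : differentiable (derive1 c) t.
  apply: (differentiable_near _ (proj1 Dc1)).
  by apply: filterS c1E => s /esym.
(* The Hessian term in this acceleration is the one that survives in [induced_koszul]. *)
have c2E : derive1 (derive1 c) t =
    derive1 (derive1 u) t *m dmx (u t) + derive1 u t *m 'D_(derive1 u t) dmx (u t).
  by rewrite (near_eq_derive1 c1E) (is_deriv_derive1 Dc1) !scale1r.
have c1t : derive1 c t = derive1 u t *m dmx (u t) by exact: nbhs_singleton c1E.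
have dc : differentiable c t.
  by have [] := is_deriv_comp (is_derivP du) (is_derivP (dq _ Wt)).
rewrite !(diff_dmx _ Wt); set z := Z *m _.
rewrite (is_deriv_derive1 (is_deriv_bilin
  (is_deriv_comp (is_deriv_curve dc) (is_derivP (G_diff Wt))) (is_deriv_curve dc1)
  (is_deriv_cst t z))).
rewrite (derive_bilin_const _ _ _ (G_diff Wt)) !scale1r bilin0r addr0 c2E c1t.
rewrite /covt mulmxDl !bilinDl (induced_koszul (X := derive1 u t) (Z := Z) Wt erefl erefl erefl) -/z -/(c t).
have aux (x y r s : R) : x + (y + r - s) = y + (x + r) - s by ring.
exact: aux.
Qed.

End InducedMetric.


(** * The unit hypersurface in one chart *)

Section UnitLocal.
Variables (R : realType) (n : nat) (U : set 'rV[R]_n) (C : christoffel R n).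
Variables (g phi : 'rV[R]_n -> 'M[R]_n).
Hypothesis oU : open U.
Hypothesis g_smooth : smooth_on U g.
Hypothesis g_sym : forall u, U u -> forall X Y, bilin (g u) X Y = bilin (g u) Y X.
Hypothesis g_pos : forall u, U u -> forall X, X != 0 -> 0 < bilin (g u) X X.
Hypothesis lcC : levi_civita U (fun u => bilin (g u)) C.
Hypothesis phi_smooth : smooth_on U phi.
Hypothesis phi_sq : forall u, U u -> phi u *m phi u = 1%:M.
Hypothesis phi_pure : forall u, U u -> forall X Y,
  bilin (g u) (X *m phi u) Y = bilin (g u) X (Y *m phi u).
Hypothesis phi_par : forall u, U u -> forall X Y : 'rV[R]_n -> 'rV[R]_n,
  differentiable Y u ->
  covd C X (fun w => Y w *m phi w) u = covd C X Y u *m phi u.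

(** The twin Norden metric g(X, phi Y); the transpose comes from the row-vector convention. *)
Definition twin (w : 'rV[R]_n) : 'M[R]_n := g w *m (phi w)^T.

Lemma twinE w X Y : bilin (twin w) X Y = bilin (g w) X (Y *m phi w).
Proof. by rewrite /bilin /twin trmx_mul !mulmxA. Qed.

Lemma twin_sym u : U u -> forall X Y, bilin (twin u) X Y = bilin (twin u) Y X.
Proof. by move=> Uu X Y; rewrite !twinE -phi_pure// g_sym. Qed.

Lemma twin_smooth k : Dk k U twin.
Proof.
move/smooth_onP: g_smooth => gs; move/smooth_onP: phi_smooth => ps.
by apply: DkMx => //; exact: DkT.
Qed.

(** Parallelism of phi, tested on a constant field Y, expresses the derivative of Y phi by
    Christoffel terms; these replace the unwanted term in the product rule for g(X, Y phi). *)
Lemma twin_parallel : parallel02 U C twin.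
Proof.
move=> u Uu Z X Y.
have gs := (smooth_onP _ _).1 g_smooth; have ps := (smooth_onP _ _).1 phi_smooth.
have dg : differentiable g u by have [+ _] := gs 1%N; exact.
have dp : differentiable phi u by have [+ _] := ps 1%N; exact.
have dYphi := is_derivMx (is_deriv_cst u Y) (is_derivP dp).
have -> : (fun w => bilin (twin w) X Y) = fun w => bilin (g w) X (Y *m phi w).
  by apply/funext => w; exact: twinE.
have [_ ->] := is_deriv_bilin (is_derivP dg) (is_deriv_cst u X) dYphi.
have := phi_par Uu (fun=> Z) (differentiable_cst Y u); rewrite /covd.
have [_ ->] := dYphi; rewrite derive_cst mul0mx !add0r => E.
have -> : Y *m 'D_Z phi u = chr C u Z Y *m phi u - chr C u Z (Y *m phi u).
  by rewrite -E addrK.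
rewrite (parallel02_derive _ _ _ (levi_civita_parallel lcC) Uu dg).
rewrite !twinE bilin0l addr0 bilinDr bilinNr.
by gen_bilin; ring.
Qed.

Let C_diff u : U u -> forall k, differentiable (fun w => C w k) u.
Proof. by move=> Uu k; exact: (levi_civita_differentiable oU g_smooth g_sym g_pos lcC). Qed.

Let C_sym u : U u -> forall X Y, chr C u X Y = chr C u Y X.
Proof. by move=> Uu; have [] := lcC Uu. Qed.

Notation S := (sas C g twin).

Lemma sas_sym z Z Z' : U (lsubmx z) -> S z Z Z' = S z Z' Z.
Proof. by move=> Uz; rewrite /sas g_sym// twin_sym. Qed.

Lemma vcompD z Z Z' : vcomp C z (Z + Z') = vcomp C z Z + vcomp C z Z'.
Proof. by rewrite /vcomp !linearD /= chrDl addrACA. Qed.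

Lemma vcompZ z a Z : vcomp C z (a *: Z) = a *: vcomp C z Z.
Proof. by rewrite /vcomp !linearZ /= chrZl scalerDr. Qed.

Lemma sasDr z Z Y Y' : S z Z (Y + Y') = S z Z Y + S z Z Y'.
Proof. by rewrite /sas linearD /= vcompD !bilinDr addrACA. Qed.

Lemma sasZr z a Z Y : S z Z (a *: Y) = a * S z Z Y.
Proof. by rewrite /sas linearZ /= vcompZ !bilinZr mulrDr. Qed.

Lemma lift_vec z (X Y : 'rV[R]_n) : exists Z, lsubmx Z = X /\ vcomp C z Z = Y.
Proof.
exists (row_mx X (Y - chr C (lsubmx z) X (rsubmx z))).
by rewrite /vcomp row_mxKl row_mxKr subrK.
Qed.

(** Horizontal test vectors detect the horizontal part by positivity of [g]. On the vertical part
    the form is indefinite, so the difference is tested against its own image under phi: the two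
    factors phi cancel and [g] decides again. *)
Lemma sas_nondeg z A B : U (lsubmx z) -> (forall Z, S z A Z = S z B Z) ->
  lsubmx A = lsubmx B /\ vcomp C z A = vcomp C z B.
Proof.
move=> Uz AB.
have pos0 (X : 'rV[R]_n) : bilin (g (lsubmx z)) X X = 0 -> X = 0.
  by move=> X0; apply/eqP; apply: contraT => /(g_pos Uz); rewrite X0 ltxx.
split; apply/eqP; rewrite -subr_eq0; apply/eqP; apply: pos0.
  have [Z [Zl Zv]] := lift_vec z (lsubmx A - lsubmx B) 0.
  have := AB Z; rewrite /sas Zl Zv !bilin0r !addr0 => E.
  by rewrite bilinDl bilinNl E subrr.
have [Z [Zl Zv]] := lift_vec z 0 ((vcomp C z A - vcomp C z B) *m phi (lsubmx z)).
have := AB Z; rewrite /sas Zl Zv !bilin0r !add0r !twinE -!mulmxA phi_sq// mulmx1 => E.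
by rewrite bilinDl bilinNl E subrr.
Qed.

(** The Gram matrix of the metric, the form in which the results on induced metrics accept it. *)
Definition sas_mx (z : 'rV[R]_(n + n)) : 'M[R]_(n + n) :=
  \matrix_(i, j) S z (delta_mx 0 i) (delta_mx 0 j).

Lemma sas_mxE z Z Z' : U (lsubmx z) -> bilin (sas_mx z) Z Z' = S z Z Z'.
Proof.
move=> Uz.
have Ssum (I : Type) (r : seq I) (F : I -> 'rV[R]_(n + n)) Y :
    S z Y (\sum_(i <- r) F i) = \sum_(i <- r) S z Y (F i).
  elim: r => [|i r IH]; last by rewrite !big_cons sasDr IH.
  rewrite !big_nil; have := sasZr z 0 Y 0.
  by rewrite scale0r mul0r.
rewrite [Z' in RHS]row_sum_delta Ssum /bilin mxE; apply: eq_bigr => j _.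
rewrite sasZr mxE [RHS]mulrC mxE; congr (_ * _).
rewrite sas_sym// [Z in RHS]row_sum_delta Ssum; apply: eq_bigr => i _.
by rewrite sasZr mxE sas_sym.
Qed.

Lemma differentiable_sas_mx z : U (lsubmx z) -> differentiable sas_mx z.
Proof.
move=> Uz; apply: differentiable_mx => i j; under eq_fun do rewrite mxE.
have gs := (smooth_onP _ _).1 g_smooth 3%N.
exact: (proj1 (is_deriv_sas C_diff gs (twin_smooth 3) _ _ Uz)).
Qed.

Section Hypersurface.
Variables (k : nat) (W : set 'rV[R]_k) (q : 'rV[R]_k -> 'rV[R]_(n + n)).
Variable Ch : christoffel R k.
Hypothesis dimE : (k + 1 = n + n)%N.
Hypothesis oW : open W.
Hypothesis q_smooth : smooth_on W q.
Hypothesis q_base : forall w, W w -> U (lsubmx (q w)).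
Hypothesis q_unit : forall w, W w ->
  bilin (twin (lsubmx (q w))) (rsubmx (q w)) (rsubmx (q w)) = 1.
Hypothesis q_inj : forall w, W w -> injective ('d q w).
Hypothesis lcCh : levi_civita W (fun w X Y => S (q w) ('d q w X) ('d q w Y)) Ch.

Let q3 : Dk 3 W q. Proof. exact: (smooth_onP _ _).1. Qed.

Lemma unit_normal w X : W w ->
  bilin (twin (lsubmx (q w))) (vcomp C (q w) (X *m dmx q w)) (rsubmx (q w)) = 0.
Proof.
move=> Ww; have Uq := q_base Ww.
have Dq := is_deriv_dmx q3 Ww.
have [dt _] := twin_smooth 1.
have D := is_deriv_bilin (is_deriv_comp (is_deriv_lsubmx Dq) (is_derivP (dt _ Uq)))
  (is_deriv_rsubmx Dq) (is_deriv_rsubmx Dq).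
have [_ /(_ X)] := D.
have -> : 'D_X (fun y => bilin (twin (lsubmx (q y))) (rsubmx (q y)) (rsubmx (q y))) w = 0.
  rewrite -(derive_cst (1 : R) w X); apply: near_eq_derive.
  by apply: filterS (open_nbhs_nbhs (conj oW Ww)) => y; exact: q_unit.
rewrite (parallel02_derive _ _ _ twin_parallel Uq (dt _ Uq)).
rewrite (twin_sym Uq (rsubmx (q w)) (rsubmx (X *m dmx q w))).
rewrite (twin_sym Uq (rsubmx (q w)) (chr _ _ _ _)) /vcomp bilinDl.
have aux (p s : R) : 0 = p + p + s + s -> s + p = 0 by lra.
exact: aux.
Qed.

(** The rows of [dmx] and the normal form a square matrix by [dimE]. In a vanishing combination,
    pairing with xi kills the tangent part and hence the normal coefficient; injectivity of dq kills
    the rest. *)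
Lemma tangent_normal_span w (Z : 'rV[R]_(n + n)) : W w ->
  exists X s, Z = X *m dmx q w + s *: row_mx 0 (rsubmx (q w)).
Proof.
move=> Ww; pose M := col_mx (dmx q w) (row_mx 0 (rsubmx (q w)) : 'rV[R]_(n + n)).
have vN : vcomp C (q w) (row_mx 0 (rsubmx (q w))) = rsubmx (q w).
  by rewrite /vcomp row_mxKl row_mxKr chr0l addr0.
have Mker (v : 'rV[R]_(k + 1)) : v *m M = 0 -> v = 0.
  rewrite -[v]hsubmxK mul_row_col [rsubmx v]mx11_scalar mul_scalar_mx.
  set s := rsubmx v 0 0 => E.
  have s0 : s = 0.
    have := congr1 (vcomp C (q w)) E; rewrite vcompD vcompZ vN.
    move/(congr1 (fun Y => bilin (twin (lsubmx (q w))) Y (rsubmx (q w)))).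
    rewrite bilinDl bilinZl unit_normal// q_unit// mulr1 add0r => ->.
    by rewrite /vcomp !linear0 chr0l addr0 bilin0l.
  move: E; rewrite s0 scale0r addr0 -(diff_dmx q3 _ Ww) => E.
  have -> : lsubmx v = 0 by apply: (q_inj Ww); rewrite E linear0.
  by rewrite raddf0 row_mx0.
have Mfree : row_free M.
  rewrite -kermx_eq0; apply/eqP/row_matrixP => i; rewrite row0.
  by apply: Mker; apply/sub_kermxP; exact: row_sub.
have Mfull : row_full M by rewrite /row_full (eqP Mfree); exact/eqP.
have /submxP[D ->] := submx_full Z Mfull.
exists (lsubmx D), (rsubmx D 0 0).
by rewrite -[in LHS](hsubmxK D) mul_row_col {1}[rsubmx D]mx11_scalar mul_scalar_mx.
Qed.

Lemma unit_covt (u : R -> 'rV[R]_k) t (r : R) :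
  W (u t) -> (\near t, differentiable u t) -> differentiable (derive1 u) t ->
  let c := fun s => q (u s) in
  let gam := fun s => lsubmx (c s) in let xi := fun s => rsubmx (c s) in
  bilin (twin (gam t)) (covt C gam xi t) (covt C gam xi t) = r ->
  let A := 'd q (u t) (covt Ch u (derive1 u) t) in
  lsubmx A = covt C gam (derive1 gam) t
     - curv C (gam t) (covt C gam xi t) (xi t *m phi (gam t)) (derive1 gam t) /\
  vcomp C (c t) A = covt C gam (covt C gam xi) t + r *: xi t.
Proof.
move=> Wt nu du1 c gam xi rE A.
have [dq _] := q3; have Ut : U (gam t) by exact: q_base.
have du : differentiable u t by exact: nbhs_singleton nu.
have nW : \forall s \near t, W (u s).
  have uc : {for t, continuous u} by exact: differentiable_continuous.
  by apply: uc; exact: open_nbhs_nbhs.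
have nc : \near t, differentiable c t.
  apply: filterS2 nu nW => s dus Ws.
  by have [] := is_deriv_comp (is_derivP dus) (is_deriv_dmx q3 Ws).
have nU : \forall s \near t, U (gam s) by apply: filterS nW => s; exact: q_base.
have Dc := is_deriv_comp (is_deriv_curve du) (is_deriv_dmx q3 Wt).
have dc : differentiable c t by have [] := Dc.
have c1E : {near t, derive1 c =1 (fun s => derive1 u s *m dmx q (u s))}.
  apply: filterS2 nu nW => s dus Ws.
  rewrite (is_deriv_derive1 (is_deriv_comp (is_deriv_curve dus) (is_deriv_dmx q3 Ws))).
  by rewrite scale1r.
have c1t : derive1 c t = derive1 u t *m dmx q (u t) by exact: nbhs_singleton c1E.
have dc1 : differentiable (derive1 c) t.
  apply: (differentiable_near _ (proj1 (is_derivMx (is_derivP du1)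
    (is_deriv_comp (is_derivP du) (is_derivP (differentiable_dmx q3 Wt)))))).
  by apply: filterS c1E => s /esym.
have dxi : differentiable xi t by have [] := is_deriv_rsubmx (is_derivP dc).
have dgam : differentiable gam t by have [] := is_deriv_lsubmx (is_derivP dc).
have gamE : {near t, (fun s => lsubmx (derive1 c s)) =1 derive1 gam}.
  by apply: filterS nc => s dcs; rewrite /gam derive1_lsubmx.
have xiE : {near t, (fun s => rsubmx (derive1 c s)) =1 derive1 xi}.
  by apply: filterS nc => s dcs; rewrite /xi derive1_rsubmx.
have dgam1 : differentiable (derive1 gam) t.
  by apply: differentiable_near gamE _; have [] := is_deriv_lsubmx (is_derivP dc1).
have dxi1 : differentiable (derive1 xi) t.
  by apply: differentiable_near xiE _; have [] := is_deriv_rsubmx (is_derivP dc1).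
have dv : differentiable (covt C gam xi) t.
  exact: differentiable_covt (C_diff Ut) _ _ _ _.
have [dt _] := twin_smooth 1.
(* The velocity is tangent at every nearby time, so its orthogonality to xi may be differentiated;
   this gives the normal component of xi''. *)
have vxi : {near t, (fun s => bilin (twin (gam s)) (covt C gam xi s) (xi s)) =1 fun=> 0}.
  apply: filterS3 nW nc c1E => s Ws dcs cs.
  have := unit_normal (derive1 u s) Ws; rewrite -cs /vcomp.
  by rewrite -(derive1_lsubmx dcs) -(derive1_rsubmx dcs).
have x2xi : bilin (twin (gam t)) (covt C gam (covt C gam xi) t) (xi t) = - r.
  have := derive1_bilin_parallel twin_parallel Ut (dt _ Ut) dgam dv dxi.
  rewrite (near_eq_derive1 vxi) derive1_cst rE => /esym/eqP.
  by rewrite addr_eq0 => /eqP.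
(* [B] is the candidate for the covariant acceleration, given by its horizontal and vertical
   parts. *)
have [B [Bl Bv]] := lift_vec (c t) (covt C gam (derive1 gam) t
     - curv C (gam t) (covt C gam xi t) (xi t *m phi (gam t)) (derive1 gam t))
     (covt C gam (covt C gam xi) t + r *: xi t).
have lc' : levi_civita W (fun w X Y => bilin (sas_mx (q w)) ('d q w X) ('d q w Y)) Ch.
  move=> w Ww; have [csym met] := lcCh Ww; split=> // Z X Y.
  have -> : 'D_Z (fun w => bilin (sas_mx (q w)) ('d q w X) ('d q w Y)) w =
      'D_Z (fun w => S (q w) ('d q w X) ('d q w Y)) w.
    apply: near_eq_derive; apply: filterS (open_nbhs_nbhs (conj oW Ww)) => w' Ww'.
    by rewrite sas_mxE//; exact: q_base.
  by have Uw := q_base Ww; rewrite met !sas_mxE.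
have mx_diff w : W w -> differentiable sas_mx (q w).
  by move=> Ww; apply: differentiable_sas_mx; exact: q_base.
have mx_sym w : W w -> forall X Y, bilin (sas_mx (q w)) X Y = bilin (sas_mx (q w)) Y X.
  by move=> Ww X Y; have Uw := q_base Ww; rewrite !sas_mxE// sas_sym.
have EL V : S (c t) A ('d q (u t) V) =
    bilin (g (gam t)) (lsubmx B) (lsubmx ('d q (u t) V)) +
    bilin (twin (gam t)) (covt C gam (covt C gam xi) t) (vcomp C (c t) ('d q (u t) V)).
  have gs := (smooth_onP _ _).1 g_smooth 3%N.
  rewrite Bl -(sas_euler_lagrange oU C_diff C_sym (levi_civita_parallel lcC) twin_parallel
    gs (twin_smooth 3) g_sym twin_sym _ Ut nc dc1 (twinE (gam t))).
  rewrite -sas_mxE// (induced_euler_lagrange oW q3 mx_diff mx_sym lc' V Wt nu du1) -/c.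
  congr (_ - _ * _).
    by apply: near_eq_derive1; apply: filterS nU => s Us; rewrite sas_mxE.
  apply: near_eq_derive.
  have lc : {for c t, continuous (@lsubmx R 1 n n)}.
    exact: (differentiable_continuous (proj1 (is_deriv_lsubmx_id (c t)))).
  have : \forall z \near c t, U (lsubmx z).
    by apply: lc; exact: open_nbhs_nbhs.
  by apply: filterS => z Uz; rewrite sas_mxE.
(* On tangent vectors the term in xi pairs to zero and [EL] applies. On the normal, [A] pairs to
   zero because it is tangent, and [B] because -r + r = 0. *)
rewrite -Bl -Bv; apply: sas_nondeg => // Z.
have [X [s ->]] := tangent_normal_span Z Wt.
rewrite !sasDr !sasZr; congr (_ + _ * _).
  rewrite -(diff_dmx q3 _ Wt) EL /sas Bv bilinDl bilinZl.
  rewrite (twin_sym Ut (xi t)) (diff_dmx q3 _ Wt) unit_normal//.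
  by rewrite mulr0 addr0.
rewrite /sas row_mxKl !bilin0r !add0r.
have -> : vcomp C (c t) (row_mx 0 (rsubmx (q (u t)))) = xi t.
  by rewrite /vcomp row_mxKl row_mxKr chr0l addr0.
rewrite /A (diff_dmx q3 _ Wt) unit_normal// Bv bilinDl bilinZl x2xi.
by rewrite /xi /gam /c q_unit// mulr1 addNr.
Qed.

End Hypersurface.
End UnitLocal.


(** * The tangent bundle *)

Lemma open_setI_preimage (T T' : topologicalType) (A : set T) (B : set T') (f : T -> T') :
  open A -> open B -> (forall x, A x -> {for x, continuous f}) ->
  open (A `&` f @^-1` B).
Proof.
move=> oA oB fc; rewrite openE => x [Ax Bfx].
apply: filterI; first exact: open_nbhs_nbhs.
by apply: (fc x Ax); exact: open_nbhs_nbhs.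
Qed.

Lemma diff_left_inverse (R : realType) (V W : normedModType R) (f : V -> W) (h : W -> V) x :
  differentiable f x -> differentiable h (f x) -> (\forall y \near x, h (f y) = y) ->
  forall v, 'd h (f x) ('d f x v) = v.
Proof.
move=> df dh hf v.
have [_ /(_ v)] := is_deriv_near hf (is_deriv_comp (is_derivP df) (is_derivP dh)).
by rewrite derive_id !deriveE.
Qed.

Section Atlas.
Variables (R : realType) (n : nat) (M : atlas R n).
Hypothesis HM : is_manifold M.
Implicit Types (a b c : chart M) (x : M) (v : 'rV[R]_n).

Lemma open_overlap a b : open (overlap a b).
Proof. exact: overlap_open. Qed.
Arguments open_overlap : clear implicits.

Lemma open_cimage a : open (cimage a).
Proof. by rewrite /cimage -[dom a]setIid; exact: open_overlap. Qed.
Arguments open_cimage : clear implicits.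

Lemma coords_overlap a b x : dom a x -> dom b x -> overlap a b (coords a x).
Proof. by move=> ax bx; exists x. Qed.

Lemma dom_overlap a b x : dom a x -> overlap a b (coords a x) -> dom b x.
Proof.
by move=> ax [y [ay dby] yx]; rewrite -(coord_inj HM ay ax yx).
Qed.

Lemma transition_differentiable a b u : overlap a b u -> differentiable (transition a b) u.
Proof.
by have /smooth_onP/(_ 1%N)[+ _] := trans_smooth HM a b; exact.
Qed.

Lemma transition_trans a b c x : dom a x -> dom b x -> dom c x ->
  \forall u \near coords a x,
    overlap a c u /\ transition b c (transition a b u) = transition a c u.
Proof.
move=> ax bx cx.
have oab := coords_overlap ax bx.
have [oa ob] := (open_overlap a b, open_overlap b c).
have tc := differentiable_continuous (transition_differentiable oab).
have n1 : nbhs (coords a x) (overlap a b) by exact: open_nbhs_nbhs.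
have n2 : nbhs (coords a x) (transition a b @^-1` overlap b c).
  apply: tc; apply: open_nbhs_nbhs; split=> //.
  by rewrite (transE HM ax bx); exact: coords_overlap.
apply: filterS2 n1 n2 => _ [y [ay dby] <-] /=.
rewrite (transE HM ay dby) => /(dom_overlap dby) cy.
by rewrite (transE HM dby cy) (transE HM ay cy); split=> //; exists y.
Qed.

Lemma transition_diff_trans a b c x v : dom a x -> dom b x -> dom c x ->
  'd (transition b c) (coords b x) ('d (transition a b) (coords a x) v) =
  'd (transition a c) (coords a x) v.
Proof.
move=> ax bx cx; rewrite -(transE HM ax bx).
have dab := transition_differentiable (coords_overlap ax bx).
have dbc : differentiable (transition b c) (transition a b (coords a x)).
  by apply: transition_differentiable; rewrite (transE HM ax bx); exact: coords_overlap.
have nE : {near coords a x, (fun u => transition b c (transition a b u)) =1 transition a c}.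
  by apply: filterS (transition_trans ax bx cx) => u [].
have [_ /(_ v)] := is_deriv_near nE (is_deriv_comp (is_derivP dab) (is_derivP dbc)).
by rewrite !deriveE//; exact/transition_differentiable/coords_overlap.
Qed.

Lemma transition_diff_id a x v : dom a x -> 'd (transition a a) (coords a x) v = v.
Proof.
move=> ax; have nE : {near coords a x, (fun u => u) =1 transition a a}.
  have : nbhs (coords a x) (overlap a a).
    by apply: open_nbhs_nbhs; split; [exact: open_overlap|exact: coords_overlap].
  by apply: filterS => _ [y [ay _] <-]; rewrite (transE HM ay ay).
exact: is_deriv_diff (is_deriv_near nE (is_deriv_id _)).
Qed.

Lemma tangent_ext a x (T T' : tangent x) : dom a x -> T a = T' a -> T = T'.
Proof.
move=> ax TT'; have E : tcomp T = tcomp T'.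
  apply/funext => b; have [bx|nbx] := pselect (dom b x).
    by rewrite (tcomp_law T ax bx) (tcomp_law T' ax bx) TT'.
  by rewrite !tcomp_out.
case: T T' E {TT'} => [t l o] [t' l' o'] /= E; subst t'.
by congr Tangent; exact: Prop_irrelevance.
Qed.

(** The components in the other charts are the images of [v] under the Jacobians from [a], and 0 off
    their domains; the transformation law is then the chain rule for coordinate changes. *)
Lemma exists_tangent a x v : dom a x -> exists T : tangent x, T a = v.
Proof.
move=> ax.
have [t [tE to]] : exists t : chart M -> 'rV[R]_n,
    (forall b, dom b x -> t b = 'd (transition a b) (coords a x) v) /\
    (forall b, ~ dom b x -> t b = 0).
  exists (fun b => if pselect (dom b x) then 'd (transition a b) (coords a x) v else 0).
  by split=> b bx; case: pselect.
have tl b c : dom b x -> dom c x -> t c = 'd (transition b c) (coords b x) (t b).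
  move=> bx cx.
  rewrite (tE b bx).
  rewrite (tE c cx).
  exact: (esym (transition_diff_trans v ax bx cx)).
by exists (Tangent tl to); rewrite /= (tE a ax) (transition_diff_id v ax).
Qed.

Local Notation tdom a p := (@dom R (n + n) (tbundle M) a p).
Local Notation tcoords a p := (@coords R (n + n) (tbundle M) a p).

Lemma tcoords_inj a (p p' : tbundle M) : tdom a p -> tdom a p' ->
  tcoords a p = tcoords a p' -> p = p'.
Proof.
case: p p' => [x T] [x' T'] /= ax ax' /eq_row_mx[xx' TT'].
have E := coord_inj HM ax ax' xx'; subst x'.
by rewrite (tangent_ext ax TT').
Qed.

Lemma tcimage a (p : tbundle M) : tdom a p -> cimage a (lsubmx (tcoords a p)).
Proof. by case: p => x T /= ax; rewrite row_mxKl; exists x. Qed.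

Lemma tdom_overlap a b (p : tbundle M) : tdom a p ->
  overlap a b (lsubmx (tcoords a p)) -> tdom b p.
Proof. by case: p => x T /= ax; rewrite row_mxKl; exact: dom_overlap. Qed.

Lemma tcoords_overlap a b (p : tbundle M) : tdom a p -> tdom b p ->
  overlap a b (lsubmx (tcoords a p)).
Proof. by case: p => x T /= ax bx; rewrite row_mxKl; exact: coords_overlap. Qed.

Lemma exists_tpoint a (z : 'rV[R]_(n + n)) : cimage a (lsubmx z) ->
  exists p : tbundle M, tdom a p /\ tcoords a p = z.
Proof.
move=> [x ax xz]; have [T Ta] := exists_tangent (rsubmx z) ax.
by exists (existT _ x T); split=> //=; rewrite xz Ta hsubmxK.
Qed.

Lemma ttransE a b (p : tbundle M) : tdom a p -> tdom b p ->
  transition (a : chart (tbundle M)) b (tcoords a p) = tcoords b p.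
Proof.
case: p => x T /= ax bx; rewrite row_mxKl row_mxKr (transE HM ax bx).
by rewrite -(tcomp_law T ax bx).
Qed.

Lemma open_lsubmx (A : set 'rV[R]_n) :
  open A -> open [set z : 'rV[R]_(n + n) | A (lsubmx z)].
Proof.
move=> oA; rewrite -[X in open X]setTI.
apply: (open_setI_preimage openT oA) => z _.
exact: (differentiable_continuous (proj1 (is_deriv_lsubmx (is_deriv_id z)))).
Qed.

(** The fibre part is expanded as a sum of vector components times partial derivatives of the base
    transition, which shows smoothness jointly in point and vector. The Jacobian costs one order,
    hence [k.+1]. *)
Lemma ttrans_smooth a b :
  smooth_on [set z | overlap a b (lsubmx z)] (transition (a : chart (tbundle M)) b).
Proof.
apply/smooth_onP => k; have oab := open_overlap a b.
have oA := open_lsubmx oab.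
have /smooth_onP ts := trans_smooth HM a b.
have dl : Dk k [set z : 'rV[R]_(n + n) | overlap a b (lsubmx z)] (@lsubmx R 1 n n).
  by apply: Dk_lsubmx => //; exact: Dk_id.
apply: (Dk_ext (f := fun z => row_mx (transition a b (lsubmx z))
  (\sum_i (rsubmx z) 0 i *: 'D_(delta_mx 0 i) (transition a b) (lsubmx z)))) => //.
  move=> z oz /=; congr row_mx; rewrite -row_sum_derive ?deriveE//;
    exact: transition_differentiable.
apply: Dk_row_mx => //; first exact: (Dk_comp oA oab).
apply: Dk_sum => // i; apply: DkZ => //.
  by apply: Dk_coord => //; apply: Dk_rsubmx => //; exact: Dk_id.
have [_ tsi] := ts k.+1; exact: (Dk_comp oA oab _ dl (tsi (delta_mx 0 i))).
Qed.

End Atlas.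
Arguments open_overlap {R n M} HM a b.
Arguments open_cimage {R n M} HM a.


(** * Local parametrizations of the unit bundle *)

(** Linear coordinates on the hyperplane z c = 0: [E] embeds the parameters as a basis of the
    kernel, [D] reads them off. A nonzero column has rank 1, so the kernel has dimension [N.-1]. *)
Lemma hyperplane_basis (R : fieldType) (N : nat) (c : 'cV[R]_N) : c != 0 ->
  exists (E : 'M[R]_(N.-1, N)) (D : 'M[R]_(N, N.-1)),
    [/\ E *m D = 1%:M, E *m c = 0 &
        forall z : 'rV[R]_N, z *m c = 0 -> z *m D *m E = z].
Proof.
move=> c0; have rE : \rank (kermx c) = N.-1.
  rewrite mxrank_ker; have : (\rank c <= 1)%N by exact: rank_leq_col.
  by rewrite leq_eqVlt ltnS leqn0 mxrank_eq0 (negPf c0) orbF => /eqP ->; rewrite subn1.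
rewrite -rE; exists (row_base (kermx c)), (pinvmx (row_base (kermx c))); split.
- by rewrite mulmxVp// row_base_free.
- by apply/sub_kermxP; rewrite eq_row_base.
- by move=> z zc; rewrite mulmxKpV// eq_row_base; exact/sub_kermxP.
Qed.

Section UnitParametrization.
Variables (R : realType) (n : nat) (M : atlas R n) (g phi : mxfield M).
Hypothesis HM : is_manifold M.
Hypothesis g_tensor : tensor02 g.
Hypothesis phi_tensor : tensor11 phi.

Local Notation tdom a p := (@dom R (n + n) (tbundle M) a p).
Local Notation tcoords a p := (@coords R (n + n) (tbundle M) a p).
Local Notation tw a := (twin (g a) (phi a)).
Local Notation sq a z := (bilin (tw a (lsubmx z)) (rsubmx z) (rsubmx z)).

(** The transformation laws of [g], phi and tangent vectors make g(xi, phi xi) independent of the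
    chart, so one chart suffices. *)
Lemma unit_tbundleP (a : chart M) (p : tbundle M) : tdom a p ->
  unit_tbundle g phi p <-> sq a (tcoords a p) = 1.
Proof.
case: p => x T /= ax; rewrite row_mxKl row_mxKr twinE; split=> [/(_ a ax)//|E b bx].
rewrite /base /fiber /= in E bx *; rewrite -E.
have oab := coords_overlap ax bx.
rewrite (g_tensor.2 a b (coords a x) oab) (transE HM ax bx) -(tcomp_law T ax bx).
by rewrite (phi_tensor.2 a b (coords a x) oab) (transE HM ax bx) -(tcomp_law T ax bx).
Qed.

Variables (a : chart M) (p0 : tbundle M).
Hypothesis p0_dom : tdom a p0.
Hypothesis p0_unit : unit_tbundle g phi p0.

Let U : set 'rV[R]_n := cimage a.
Let oU : open U. Proof. exact: open_cimage. Qed.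
Let tw_smooth k : Dk k U (tw a).
Proof. by apply: twin_smooth => //; [exact: g_tensor.1|exact: phi_tensor.1]. Qed.

Let z0 := tcoords a p0.
(* Parametrization by radial projection in the fibres: [qa] rescales the vector part of
   the points of the affine hyperplane [ell = 1] so that they become unit, and [psi]
   is its inverse, which rescales them back to [ell = 1]. *)
Let ell (z : 'rV[R]_(n + n)) : R := bilin (tw a (lsubmx z0)) (rsubmx z0) (rsubmx z).
Let cvec : 'cV[R]_(n + n) := col_mx 0 (rsubmx z0 *m tw a (lsubmx z0))^T.

Let ell0 : ell z0 = 1. Proof. exact/(unit_tbundleP p0_dom). Qed.

Let ellE z : z *m cvec = (ell z)%:M.
Proof.
rewrite /cvec -[z in LHS]hsubmxK mul_row_col mulmx0 add0r [LHS]mx11_scalar; congr _%:M.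
by rewrite /ell /bilin -[in RHS](trmxK (rsubmx z0 *m _)) -trmx_mul [RHS]mxE.
Qed.

Let is_deriv_ell z : is_deriv z ell ell.
Proof.
apply: is_deriv_eq (is_deriv_bilin (is_deriv_cst z _) (is_deriv_cst z _)
  (is_deriv_rsubmx (is_deriv_id z))) _ => v.
by rewrite /ell bilin0l /bilin mulmx0 !mul0mx mxE !add0r.
Qed.

Let cvec_neq0 : cvec != 0.
Proof.
apply/eqP => c0; have := ellE z0; rewrite ell0 c0 mulmx0 => /matrixP/(_ 0 0).
by rewrite !mxE eqxx => /eqP; rewrite eq_sym oner_eq0.
Qed.

Section Slice.
Variables (E : 'M[R]_((n + n).-1, n + n)) (D : 'M[R]_(n + n, (n + n).-1)).
Hypothesis ED : E *m D = 1%:M.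
Hypothesis Ec : E *m cvec = 0.
Hypothesis DE : forall z : 'rV[R]_(n + n), z *m cvec = 0 -> z *m D *m E = z.

Let affine (w : 'rV[R]_((n + n).-1)) : 'rV[R]_(n + n) := z0 + w *m E.
Let qa w : 'rV[R]_(n + n) :=
  row_mx (lsubmx (affine w)) ((Num.sqrt (sq a (affine w)))^-1 *: rsubmx (affine w)).
Let psi (z : 'rV[R]_(n + n)) : 'rV[R]_((n + n).-1) :=
  (row_mx (lsubmx z) ((ell z)^-1 *: rsubmx z) - z0) *m D.
(** The half-space where rescaling to [ell = 1] uses a positive factor; without the sign, a vector
    and its opposite would have the same image under [psi]. *)
Let V : set 'rV[R]_(n + n) := [set z | 0 < ell z].
(** As g(., phi .) is indefinite, a point of the affine slice can be normalized only where its
    square is positive. *)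
Let pd : set 'rV[R]_((n + n).-1) :=
  [set w | U (lsubmx (affine w))] `&` (fun w => sq a (affine w)) @^-1` [set r | 0 < r].

Let ell_affine w : ell (affine w) = 1.
Proof.
have := ellE (affine w); rewrite mulmxDl -mulmxA Ec mulmx0 addr0 ellE ell0.
by move=> /matrixP/(_ 0 0); rewrite !mxE eqxx.
Qed.

Let ell_scale x y r : ell (row_mx x (r *: y)) = r * ell (row_mx x y).
Proof. by rewrite /ell !row_mxKr bilinZr. Qed.

Let ell_qa w : ell (qa w) = (Num.sqrt (sq a (affine w)))^-1.
Proof. by rewrite /qa ell_scale hsubmxK ell_affine mulr1. Qed.

Let qa_V w : pd w -> V (qa w).
Proof. by move=> [_ sq0]; rewrite /V /= ell_qa invr_gt0 sqrtr_gt0. Qed.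

Let qa_base w : lsubmx (qa w) = lsubmx (affine w).
Proof. by rewrite row_mxKl. Qed.

Let psi_qa w : pd w -> psi (qa w) = w.
Proof.
move=> pw; rewrite /psi ell_qa qa_base row_mxKr scalerA mulVf; last first.
  by rewrite invr_neq0// gt_eqF// sqrtr_gt0; case: pw.
by rewrite scale1r hsubmxK /affine addrC addKr -mulmxA ED mulmx1.
Qed.

Let affine_psi z : V z -> affine (psi z) = row_mx (lsubmx z) ((ell z)^-1 *: rsubmx z).
Proof.
move=> Vz.
have zc : (row_mx (lsubmx z) ((ell z)^-1 *: rsubmx z) - z0) *m cvec = 0.
  rewrite mulmxBl (ellE (row_mx _ _)) (ellE z0) ell_scale hsubmxK ell0.
  by rewrite mulVf ?subrr// gt_eqF.
by rewrite /affine /psi (DE zc) addrC subrK.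
Qed.

Let psi_pd z : U (lsubmx z) -> V z -> sq a z = 1 -> pd (psi z) /\ qa (psi z) = z.
Proof.
move=> Uz Vz z1; have ez := affine_psi Vz.
have sqE : sq a (affine (psi z)) = (ell z)^-1 ^+ 2.
  by rewrite ez row_mxKl row_mxKr bilinZl bilinZr z1 mulr1 expr2.
split; first by rewrite /pd /= sqE ez row_mxKl exprn_gt0// invr_gt0.
rewrite /qa sqE ez row_mxKl row_mxKr sqrtr_sqr ger0_norm ?invr_ge0 ?ltW// invrK.
by rewrite scalerA mulfV ?gt_eqF// scale1r hsubmxK.
Qed.

Let Dk_affine k A : open A -> Dk k A affine.
Proof.
move=> oA; apply: DkD => //; first exact: Dk_cst.
by apply: DkMx => //; [exact: Dk_id|exact: Dk_cst].
Qed.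

Let oA1 : open [set w | U (lsubmx (affine w))].
Proof.
have /= c : forall w, [set: 'rV[R]_((n + n).-1)] w -> {for w, continuous affine}.
  move=> w _; have [+ _] := Dk_affine 1 openT => /(_ w I) d.
  exact: (differentiable_continuous d).
by have := open_setI_preimage openT (open_lsubmx oU) c; rewrite setTI.
Qed.

Let Dk_sq k : Dk k [set w | U (lsubmx (affine w))] (fun w => sq a (affine w)).
Proof.
have da := Dk_affine k oA1; have dr := Dk_rsubmx oA1 da.
exact: (Dk_bilin oA1 (Dk_comp oA1 oU _ (Dk_lsubmx oA1 da) (tw_smooth k)) dr dr).
Qed.

Let opd : open pd.
Proof.
have c w : U (lsubmx (affine w)) -> {for w, continuous (fun w => sq a (affine w))}.
  by move=> Uw; have [d _] := Dk_sq 1; exact: (differentiable_continuous (d w Uw)).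
have o0 : open [set r : R | 0 < r] by exact: open_gt.
exact: (open_setI_preimage oA1 o0 c).
Qed.

Let Dk_qa k : Dk k pd qa.
Proof.
have da := Dk_affine k opd.
have ds : Dk k pd (fun w => sq a (affine w)) by apply: Dk_sub (Dk_sq k) => w [].
have di : Dk k pd (fun w => (Num.sqrt (sq a (affine w)))^-1).
  by apply: Dk_invsqrt => // w [].
exact: (Dk_row_mx opd (Dk_lsubmx opd da) (DkZ opd di (Dk_rsubmx opd da))).
Qed.

Let qa_cont w : pd w -> {for w, continuous qa}.
Proof. by move=> pw; have [d _] := Dk_qa 1; exact: (differentiable_continuous (d w pw)). Qed.

Let oV : open V.
Proof.
have c : forall z, [set: 'rV[R]_(n + n)] z -> {for z, continuous ell}.
  by move=> z _; exact: (differentiable_continuous (proj1 (is_deriv_ell z))).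
have o0 : open [set r : R | 0 < r] by exact: open_gt.
by have := open_setI_preimage openT o0 c; rewrite setTI.
Qed.

Let Dk_psi k : Dk k V psi.
Proof.
have di : Dk k V (fun z => z) by exact: Dk_id.
have dl : Dk k V (fun z => (ell z)^-1).
  by apply: DkV => // [z /lt0r_neq0 //|]; exact: Dk_linear.
apply: (DkMx oV _ (Dk_cst _ _ _)).
apply: (DkD oV _ (Dk_cst _ _ _)).
exact: (Dk_row_mx oV (Dk_lsubmx oV di) (DkZ oV dl (Dk_rsubmx oV di))).
Qed.

(** Beside the parametrization, its inverse is provided as a map [h] smooth on an open set of the
    ambient coordinates, so that composing with [h] turns a smooth curve of unit vectors into a
    smooth curve of parameters. *)
Lemma exists_unit_param_of_basis :
  exists (P : unit_param g phi) (h : 'rV[R]_(n + n) -> 'rV[R]_((n + n).-1))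
      (W : set 'rV[R]_(n + n)),
    [/\ open W, W (tcoords a p0), smooth_on W h &
     forall p : tbundle M, tdom a p -> unit_tbundle g phi p -> W (tcoords a p) ->
       pdom P (h (tcoords a p)) /\ P (h (tcoords a p)) = p].
Proof.
(* A total function from coordinates to points is chosen, with [p0] as default value outside the
   chart. *)
have ex_pt (z : 'rV[R]_(n + n)) : exists p : tbundle M,
    U (lsubmx z) -> tdom a p /\ tcoords a p = z.
  have [Uz|nUz] := pselect (U (lsubmx z)); last by exists p0.
  by have [p pP] := exists_tpoint HM Uz; exists p.
have [pt ptP] := choice ex_pt.
have Uq w : pd w -> U (lsubmx (qa w)) by move=> [Uw _]; rewrite qa_base.
have qdom w (pw : pd w) : tdom a (pt (qa w)) := (ptP _ (Uq w pw)).1.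
have qcoord w (pw : pd w) : tcoords a (pt (qa w)) = qa w := (ptP _ (Uq w pw)).2.
have pt_coords p : tdom a p -> pt (tcoords a p) = p.
  by move=> ap; have [d c] := ptP _ (tcimage ap); exact: (tcoords_inj HM d ap c).
have setE b : pd `&` [set w | tdom b (pt (qa w))] =
    pd `&` qa @^-1` [set z | overlap a b (lsubmx z)].
  apply/seteqP; split=> w [pw bw]; split=> //=.
    by rewrite -(qcoord w pw); exact: (tcoords_overlap (qdom w pw) bw).
  by apply: (tdom_overlap HM (qdom w pw)); rewrite (qcoord w pw).
have oset b : open (pd `&` [set w | tdom b (pt (qa w))]).
  rewrite setE.
  exact: (open_setI_preimage opd (open_lsubmx (open_overlap HM a b)) qa_cont).
have Dcb b k : Dk k (pd `&` [set w | tdom b (pt (qa w))]) (fun w => tcoords b (pt (qa w))).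
  have dq : Dk k (pd `&` [set w | tdom b (pt (qa w))]) qa by apply: Dk_sub (Dk_qa k) => w [].
  have /smooth_onP/(_ k) dt := ttrans_smooth HM a b.
  have oo : open [set z : 'rV[R]_(n + n) | overlap a b (lsubmx z)].
    by apply: open_lsubmx; exact: open_overlap.
  apply: Dk_ext (Dk_comp (oset b) oo _ dq dt); first exact: oset.
    move=> w [pw bw]; rewrite -[in LHS](qcoord w pw).
    exact: (ttransE HM (qdom w pw) bw).
  by move=> w; rewrite setE => -[].
have p_in w : pd w -> unit_tbundle g phi (pt (qa w)).
  move=> pw; apply/(unit_tbundleP (qdom w pw)); rewrite (qcoord w pw) row_mxKl row_mxKr.
  have s0 : 0 < sq a (affine w) by case: pw.
  rewrite bilinZl bilinZr mulrA -invfM -expr2 sqr_sqrtr ?ltW// mulVf//.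
  by rewrite gt_eqF.
have p_inj w w' : pd w -> pd w' -> pt (qa w) = pt (qa w') -> w = w'.
  move=> pw pw' E1; rewrite -(psi_qa pw) -(psi_qa pw').
  by rewrite -(qcoord w pw) -(qcoord w' pw') E1.
have p_smooth b : open (pd `&` [set w | tdom b (pt (qa w))]) /\
    smooth_on (pd `&` [set w | tdom b (pt (qa w))]) (fun w => tcoords b (pt (qa w))).
  by split; [exact: oset|apply/smooth_onP => k; exact: Dcb].
(* The transition from [b] to [a] followed by [psi] is a differentiable left inverse, so the
   differential is injective. *)
have p_imm b w : pd w -> tdom b (pt (qa w)) ->
    injective ('d (fun w' => tcoords b (pt (qa w'))) w).
  move=> pw bw; pose tr := transition (b : chart (tbundle M)) a.
  have nw : nbhs w (pd `&` [set w | tdom b (pt (qa w))]) by apply: open_nbhs_nbhs.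
  have [dF _] := Dcb b 1; have dFw := dF w (conj pw bw).
  have trE : tr (tcoords b (pt (qa w))) = qa w.
    by rewrite -[RHS](qcoord w pw); exact: (ttransE HM bw (qdom w pw)).
  have dtr : differentiable tr (tcoords b (pt (qa w))).
    have /smooth_onP/(_ 1%N)[dt _] := ttrans_smooth HM b a.
    by apply: dt; exact: (tcoords_overlap bw (qdom w pw)).
  have dH : differentiable (fun z => psi (tr z)) (tcoords b (pt (qa w))).
    apply: (differentiable_comp dtr); rewrite trE.
    by have [d _] := Dk_psi 1; apply: d; exact: qa_V.
  have leftinv : \forall w' \near w, psi (tr (tcoords b (pt (qa w')))) = w'.
    apply: filterS nw => w' [pw' bw'].
    by rewrite /tr (ttransE HM bw' (qdom w' pw')) (qcoord w' pw') psi_qa.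
  exact: can_inj (diff_left_inverse dFw dH leftinv).
(* The image of [O] is cut out of the unit bundle by the points over the chart, in the half-space
   [V], whose parameters [psi] lie in [O]; this uses that [qa] inverts [psi] on unit vectors. *)
have p_open (O : set 'rV[R]_((n + n).-1)) : open O -> O `<=` pd ->
    exists O' : set (tbundle M), aopen O' /\
      (fun w => pt (qa w)) @` O = O' `&` unit_tbundle g phi.
  move=> oO Opd; exists [set p | tdom a p /\ (V `&` psi @^-1` O) (tcoords a p)]; split.
    move=> p /= [ap Vp]; exists a; split=> //.
    have oVO : open (V `&` psi @^-1` O).
      apply: (open_setI_preimage oV oO) => z Vz.
      by have [d _] := Dk_psi 1; exact: (differentiable_continuous (d z Vz)).
    have oZ : open ([set z : 'rV[R]_(n + n) | U (lsubmx z)] `&` (V `&` psi @^-1` O)).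
      by apply: openI => //; exact: open_lsubmx.
    have Up := tcimage ap.
    have nZ : nbhs (tcoords a p)
        ([set z : 'rV[R]_(n + n) | U (lsubmx z)] `&` (V `&` psi @^-1` O)).
      by apply: open_nbhs_nbhs.
    apply: filterS nZ => z [Uz Vz]; have [d c] := ptP z Uz.
    have Vpt : (V `&` psi @^-1` O) (tcoords a (pt z)) by rewrite c.
    by exists (pt z); [split; [exact: d|split; [exact: d|exact: Vpt]]|exact: c].
  apply/seteqP; split=> [_ [w Ow <-]|p [[ap [Vp Op]] up]].
    have pw := Opd _ Ow; split; last exact: p_in.
    split; first exact: qdom.
    by rewrite (qcoord w pw); split; [exact: qa_V|rewrite /= psi_qa].
  exists (psi (tcoords a p)) => //.
  have [_ ->] := psi_pd (tcimage ap) Vp ((unit_tbundleP ap).1 up).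
  exact: pt_coords.
exists (Lparam opd p_in p_inj p_smooth p_imm p_open), psi, V; split.
- exact: oV.
- by rewrite /V /= ell0 ltr01.
- by apply/smooth_onP => k; exact: Dk_psi.
move=> p ap up Vp; have [pw qE] := psi_pd (tcimage ap) Vp ((unit_tbundleP ap).1 up).
by split=> //=; rewrite qE pt_coords.
Qed.

End Slice.

Lemma exists_unit_param :
  exists (P : unit_param g phi) (h : 'rV[R]_(n + n) -> 'rV[R]_((n + n).-1))
      (W : set 'rV[R]_(n + n)),
    [/\ open W, W (tcoords a p0), smooth_on W h &
     forall p : tbundle M, tdom a p -> unit_tbundle g phi p -> W (tcoords a p) ->
       pdom P (h (tcoords a p)) /\ P (h (tcoords a p)) = p].
Proof.
have [E [D [ED Ec DE]]] := hyperplane_basis cvec_neq0.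
exact: exists_unit_param_of_basis ED Ec DE.
Qed.

End UnitParametrization.


(** * The covariant acceleration *)

Section Germs.
Variable R : realType.

Lemma near_derive1 (W : normedModType R) (f f' : R -> W) (t : R) :
  {near t, f =1 f'} -> {near t, derive1 f =1 derive1 f'}.
Proof.
move=> ff'; apply: filterS (nbhs_interior ff') => s sE.
exact: near_eq_derive1.
Qed.

Lemma near_covt n (C : christoffel R n) (c c' V V' : R -> 'rV[R]_n) (t : R) :
  {near t, c =1 c'} -> {near t, V =1 V'} -> {near t, covt C c V =1 covt C c' V'}.
Proof.
move=> cc' VV'; near=> s; rewrite /covt.
rewrite (near (near_derive1 VV') s)// (near (near_derive1 cc') s)//.
by rewrite (near cc' s)// (near VV' s).
Unshelve. all: by end_near. Qed.

Lemma smooth_curve_derivable (W : normedModType R) (f : R -> W) (J : set R) (t : R) :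
  open J -> J t -> smooth_on J f ->
  (\near t, differentiable f t) /\ differentiable (derive1 f) t.
Proof.
move=> oJ Jt /smooth_onP fs; split.
  by have [df _] := fs 1%N; apply: filterS (open_nbhs_nbhs (conj oJ Jt)).
have [_ /(_ 1)[d1 _]] := fs 2%N.
have -> : derive1 f = (fun s => 'D_1 f s) by apply/funext => s; rewrite derive1E.
exact: d1.
Qed.

End Germs.

Lemma bilin_dim0 (R : realType) n (B : 'M[R]_n) X Y : n = 0%N -> bilin B X Y = 0.
Proof.
move=> n0; rewrite /bilin mxE big1// => j _; exfalso.
by have := leq_ltn_trans (leq0n _) (ltn_ord j); rewrite n0.
Qed.

(** * The covariant acceleration of a curve in the unit bundle *)

Section PushForward.
Variables (R : realType) (n : nat) (M : atlas R n).
Variables (g phi : mxfield M) (nab : connection M).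
Hypothesis HM : is_manifold M.
Hypothesis HP : para_kahler_norden g phi nab.
Variable nabh : unit_connection g phi.
Hypothesis Hnabh : unit_levi_civita nab nabh.

Lemma sasakiE a z Z Z' :
  sasaki g phi nab a z Z Z' = sas (nab a) (g a) (twin (g a) (phi a)) z Z Z'.
Proof. by rewrite /sasaki /sas twinE. Qed.

Lemma hlift11_parts F a z Z :
  lsubmx (hlift11 nab F a z Z) = lsubmx Z *m F a (lsubmx z) /\
  vpart nab a z (hlift11 nab F a z Z) = vpart nab a z Z *m F a (lsubmx z).
Proof.
rewrite /hlift11 /hlift /vlift add_row_mx addr0; split; first by rewrite row_mxKl.
by rewrite {1}/vpart row_mxKl row_mxKr addrAC addNr add0r.
Qed.

Lemma vpart_inj a z Z Z' : lsubmx Z = lsubmx Z' -> vpart nab a z Z = vpart nab a z Z' ->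
  Z = Z'.
Proof.
move=> ZZ' /eqP; rewrite /vpart ZZ' (inj_eq (addIr _)) => /eqP rZ.
by rewrite -[Z]hsubmxK ZZ' rZ hsubmxK.
Qed.

(** The local computation transported from [q] composed with [u] to [Gam]. The two curves agree only
    on [J], so everything to be differentiated is compared as a germ at [t]. *)
Lemma pushed_covt (b : chart M) (P : unit_param g phi) (Gam : R -> tbundle M)
    (u : R -> 'rV[R]_((n + n).-1)) (J : set R) (t r : R) :
  open J -> J t -> smooth_on J u ->
  (forall s, J s -> pdom P (u s) /\ P (u s) = Gam s) ->
  dom b (base (Gam t)) ->
  let gam := fun s => coords b (base (Gam s)) in let xi := fun s => fiber (Gam s) b in
  let xi1 := covt (nab b) gam xi in
  r = bilin (g b (gam t)) (xi1 t) (xi1 t *m phi b (gam t)) ->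
  let A := 'd (fun w => coords (a := tbundle M) b (P w)) (u t)
       (covt (nabh P) u (derive1 u) t) in
  lsubmx A = covt (nab b) gam (derive1 gam) t
    - curv (nab b) (gam t) (xi1 t) (xi t *m phi b (gam t)) (derive1 gam t) /\
  vpart nab b (coords (a := tbundle M) b (Gam t)) A
    = covt (nab b) gam xi1 t + r *: xi t.
Proof.
move=> oJ Jt su PJ bt gam xi xi1 rE A.
have oU := open_cimage HM b.
have [nu du1] := smooth_curve_derivable oJ Jt su.
pose q w := coords (a := tbundle M) b (P w).
pose W := pdom P `&` [set w | dom (a := tbundle M) b (P w)].
have [oW sq] := pfun_smooth P b.
have Wt : W (u t) by have [pu Pu] := PJ t Jt; split=> //=; rewrite Pu.
have [gt gr] := pkn_riemannian HP; have pt := pkn_tensor HP.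
have lc : levi_civita W (fun w X Y =>
    sas (nab b) (g b) (twin (g b) (phi b)) (q w) ('d q w X) ('d q w Y)) (nabh P).
  have sE : (fun w X Y => sas (nab b) (g b) (twin (g b) (phi b)) (q w) ('d q w X) ('d q w Y))
      = (fun w X Y => sasaki g phi nab b (q w) ('d q w X) ('d q w Y)).
    by apply/funext => w; apply/funext => X; apply/funext => Y; rewrite sasakiE.
  by rewrite sE; exact: Hnabh.
(* In dimension 0 the truncated predecessor would break [dimE]; the existence of a unit vector
   excludes that case. *)
have n_gt0 : (0 < n + n)%N.
  have uG : unit_tbundle g phi (Gam t).
    by have [pu <-] := PJ t Jt; exact: pfun_in.
  rewrite addn_gt0 orbb lt0n; apply/eqP => n0; have /eqP := uG b bt.
  by rewrite bilin_dim0// eq_sym oner_eq0.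
have cE : {near t, (fun s => q (u s)) =1 (fun s => coords (a := tbundle M) b (Gam s))}.
  by apply: filterS (open_nbhs_nbhs (conj oJ Jt)) => s /PJ[_ E]; rewrite /q E.
have gamE : {near t, (fun s => lsubmx (q (u s))) =1 gam}.
  by apply: filterS cE => s ->; rewrite row_mxKl.
have xiE : {near t, (fun s => rsubmx (q (u s))) =1 xi}.
  by apply: filterS cE => s ->; rewrite row_mxKr.
have xi1E := near_covt (nab b) gamE xiE.
have xi2E := near_covt (nab b) gamE xi1E.
have gam2E := near_covt (nab b) gamE (near_derive1 gamE).
have gt_ := nbhs_singleton gamE; have xt_ := nbhs_singleton xiE.
have dimE : ((n + n).-1 + 1 = n + n)%N by rewrite addn1 prednK.
have qE w : W w -> cimage b (lsubmx (q w)) by case=> _; exact: tcimage.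
have q1 w : W w ->
    bilin (twin (g b) (phi b) (lsubmx (q w))) (rsubmx (q w)) (rsubmx (q w)) = 1.
  by move=> [pw bw]; apply/(unit_tbundleP HM gt pt bw); exact: pfun_in.
have qinj w : W w -> injective ('d q w) by case; exact: pfun_immersion.
have rE' : bilin (twin (g b) (phi b) (lsubmx (q (u t))))
    (covt (nab b) (fun s => lsubmx (q (u s))) (fun s => rsubmx (q (u s))) t)
    (covt (nab b) (fun s => lsubmx (q (u s))) (fun s => rsubmx (q (u s))) t) = r.
  by rewrite (nbhs_singleton xi1E) gt_ twinE rE.
have [A1 A2] := unit_covt oU (gt.1 b) (fun u Uu => (gr b u Uu).1) (fun u Uu => (gr b u Uu).2)
  (pkn_levi_civita HP (a := b)) (pt.1 b) (fun u Uu => pkn_sq HP Uu) (fun u Uu => pkn_pure HP Uu)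
  (fun u Uu => pkn_parallel HP Uu) dimE oW sq qE q1 qinj lc Wt nu du1 rE'.
have gam1E := nbhs_singleton (near_derive1 gamE).
have congrH (X X' x x' v v' y y' d d' : 'rV[R]_n) : X = X' -> x = x' -> v = v' -> y = y' ->
    d = d' -> X - curv (nab b) x v (y *m phi b x) d
            = X' - curv (nab b) x' v' (y' *m phi b x') d'.
  by move=> -> -> -> -> ->.
have congrV (X X' y y' : 'rV[R]_n) : X = X' -> y = y' -> X + r *: y = X' + r *: y'.
  by move=> -> ->.
split.
  refine (etrans A1 _).
  exact: (congrH _ _ _ _ _ _ _ _ _ _ (nbhs_singleton gam2E) gt_ (nbhs_singleton xi1E) xt_ gam1E).
rewrite -(nbhs_singleton cE); refine (etrans A2 _).
exact: (congrV _ _ _ _ (nbhs_singleton xi2E) xt_).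
Qed.

Lemma velocity_parts (b : chart M) (Gam : R -> tbundle M) (t : R) :
  let c := fun s => coords (a := tbundle M) b (Gam s) in
  let gam := fun s => coords b (base (Gam s)) in let xi := fun s => fiber (Gam s) b in
  differentiable c t ->
  lsubmx (derive1 c t) = derive1 gam t /\
  vpart nab b (c t) (derive1 c t) = covt (nab b) gam xi t.
Proof.
move=> c gam xi dc.
have gE : (fun s => lsubmx (c s)) = gam by apply/funext => s; rewrite row_mxKl.
have xE : (fun s => rsubmx (c s)) = xi by apply/funext => s; rewrite row_mxKr.
have g1 : lsubmx (derive1 c t) = derive1 gam t by rewrite -gE derive1_lsubmx.
have x1 : rsubmx (derive1 c t) = derive1 xi t by rewrite -xE derive1_rsubmx.
by split; rewrite // /vpart g1 x1 row_mxKl row_mxKr.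
Qed.

(** The equivalence is for one fixed parametrization and one time. It thus serves both directions of
    the theorem: with a constructed parametrization, and with an arbitrary given one. *)
Lemma HF_equationP (F : mxfield M) (b : chart M) (Gam : R -> tbundle M)
    (u : R -> 'rV[R]_((n + n).-1)) (P : unit_param g phi) (J : set R) (t r : R) :
  open J -> J t -> smooth_on J u ->
  (forall s, J s -> pdom P (u s) /\ P (u s) = Gam s) ->
  dom b (base (Gam t)) ->
  let c := fun s => coords (a := tbundle M) b (Gam s) in
  let gam := fun s => coords b (base (Gam s)) in let xi := fun s => fiber (Gam s) b in
  let xi1 := covt (nab b) gam xi in
  differentiable c t ->
  r = bilin (g b (gam t)) (xi1 t) (xi1 t *m phi b (gam t)) ->
  'd (fun w => coords (a := tbundle M) b (P w)) (u t) (covt (nabh P) u (derive1 u) t)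
    = hlift11 nab F b (c t) (derive1 c t) <->
  covt (nab b) gam (derive1 gam) t
    = curv (nab b) (gam t) (xi1 t) (xi t *m phi b (gam t)) (derive1 gam t)
      + derive1 gam t *m F b (gam t) /\
  covt (nab b) gam xi1 t = xi1 t *m F b (gam t) - r *: xi t.
Proof.
move=> oJ Jt su PJ bt c gam xi xi1 dc rE.
have [] := pushed_covt oJ Jt su PJ bt rE; rewrite -/gam -/xi -/xi1 -/(c t).
have [g1 v1] := velocity_parts dc; rewrite -/gam -/xi -/xi1 in g1 v1.
have [Fl Fv] := hlift11_parts F b (c t) (derive1 c t).
have ct : lsubmx (c t) = gam t by rewrite row_mxKl.
rewrite g1 ct in Fl; rewrite v1 ct in Fv.
move: ('d _ _ _) (hlift11 _ _ _ _ _) Fl Fv => A B Bl Bv Al Av; split=> [AB|[gE xE]].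
  split; first by rewrite -Bl -AB Al addrCA subrr addr0.
  by rewrite -Bv -AB Av addrK.
apply: (vpart_inj (a := b) (z := c t)).
  by rewrite Al Bl gE addrAC subrr add0r.
by rewrite Av Bv xE subrK.
Qed.

End PushForward.

Theorem theorem5p11 (R : realType) (m : nat) (M : atlas R m.*2)
  (g phi : mxfield M) (nab : connection M)
  (HM : is_manifold M) (HP : para_kahler_norden g phi nab)
  (nabh : unit_connection g phi) (Hnabh : unit_levi_civita nab nabh)
  (F : mxfield M) (HF : tensor11 F)
  (I : set R) (Iopen : open I) (Iint : is_interval I)
  (Gam : R -> tbundle M) (Gam_smooth : smooth_curve I Gam)
  (Gam_unit : forall t, I t -> unit_tbundle g phi (Gam t))
  (rho : R) (Hrho : 0 <= rho <= 1) :
  let gamma (a : chart M) : R -> 'rV[R]_(m.*2) :=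
    fun t => coords a (base (Gam t)) in
  let xi (a : chart M) : R -> 'rV[R]_(m.*2) := fun t => fiber (Gam t) a in
  let gamma' a := derive1 (gamma a) in
  let gamma'' a := covt (nab a) (gamma a) (gamma' a) in
  let xi' a := covt (nab a) (gamma a) (xi a) in
  let xi'' a := covt (nab a) (gamma a) (xi' a) in
  (forall t a, I t -> dom a (base (Gam t)) ->
     rho ^+ 2 =
     bilin (g a (gamma a t)) (xi' a t) (xi' a t *m phi a (gamma a t))) ->
  HF_geodesic nab nabh F I Gam <->
  (forall t a, I t -> dom a (base (Gam t)) ->
     gamma'' a t =
       curv (nab a) (gamma a t) (xi' a t) (xi a t *m phi a (gamma a t))
            (gamma' a t)
       + gamma' a t *m F a (gamma a t) /\
     xi'' a t = xi' a t *m F a (gamma a t) - rho ^+ 2 *: xi a t).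
Proof.
move=> gamma xi gamma' gamma'' xi' xi'' rhoE.
have dGam a t : I t -> dom a (base (Gam t)) ->
    differentiable (fun s => coords (a := tbundle M) a (Gam s)) t.
  move=> It at_; have [_ /smooth_onP/(_ 1%N)[d _]] := Gam_smooth a.
  by apply: d; split.
split=> [geo t a It at_|eqs t It P u J oJ Jt su PJ b bt c].
  have [P [h [W [oW Wt sh hP]]]] := exists_unit_param HM (pkn_riemannian HP).1
    (pkn_tensor HP) at_ (Gam_unit t It).
  have [oIa sGam] := Gam_smooth a.
  pose c s := coords (a := tbundle M) a (Gam s).
  (* The times at which the curve stays in the chart and in the domain of [h]; there [h (c s)] is
     its parameter curve. *)
  pose J := (I `&` [set s | dom (a := tbundle M) a (Gam s)]) `&` c @^-1` W.
  have oJ : open J.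
    apply: (open_setI_preimage oIa oW) => s [Is as_].
    exact: (differentiable_continuous (dGam a s Is as_)).
  have Jt : J t by [].
  have su : smooth_on J (fun s => h (c s)).
    apply/smooth_onP => k.
    apply: (Dk_comp oJ oW _ _ ((smooth_onP _ _).1 sh k)); first by move=> s [].
    by apply: Dk_sub ((smooth_onP _ _).1 sGam k) => s [].
  have PJ s : J s -> pdom P (h (c s)) /\ P (h (c s)) = Gam s.
    by move=> [[Is as_] Ws]; apply: hP => //; exact: Gam_unit.
  apply/(HF_equationP HM HP Hnabh F oJ Jt su PJ at_ (dGam a t It at_) (rhoE t a It at_)).
  exact: (geo t It P _ J oJ Jt su PJ a at_).
(* Conversely the parametrization is given, and the pointwise equations in the chart [b] at time [t]
   suffice. *)
apply/(HF_equationP HM HP Hnabh F oJ Jt su PJ bt (dGam b t It bt) (rhoE t b It bt)).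
exact: eqs.
Qed.
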